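(* Let $T$ be a $k$-uniform hypertree, and let $\mathcal{L}(T)$ be the Laplacian tensor of $T$. Then $$\mathrm{am}(0,\mathcal{L}(T))=|\mathbb{V}_0(\mathcal{L}(T))|,$$ where the right-hand side is the number of points of the projective eigenvariety of $\mathcal{L}(T)$ associated with the eigenvalue $0$. Consequently, equality holds in the Hu-Ye inequality for the zero eigenvalue of $\mathcal{L}(T)$: if $V_1,\ldots,V_\kappa$ are all the irreducible components of the affine eigenvariety $\mathcal{V}_0(\mathcal{L}(T))$, then $$\mathrm{am}(0,\mathcal{L}(T))=\sum_{i=1}^{\kappa}\dim(V_i)(k-1)^{\dim(V_i)-1}.$$
   Context: Tensors. A tensor $\mathcal{A}=(a_{i_1\ldots i_k})$ of order $k\ge 2$ and dimension $n$ is an array of entries $a_{i_1\ldots i_k}\in\mathbb{C}$, $i_1,\ldots,i_k\in[n]=\{1,\ldots,n\}$. For $x\in\mathbb{C}^n$, $(\mathcal{A}x^{k-1})_i=\sum_{i_2,\ldots,i_k\in[n]}a_{ii_2\ldots i_k}x_{i_2}\cdots x_{i_k}$, and $x^{[k-1]}=(x_1^{k-1},\ldots,x_n^{k-1})$. A number $\lambda\in\mathbb{C}$ is an eigenvalue of $\mathcal{A}$ if $\mathcal{A}x^{k-1}=\lambda x^{[k-1]}$ for some $x\in\mathbb{C}^n\setminus\{0\}$. The characteristic polynomial $\varphi_{\mathcal{A}}(\lambda)$ is the (multivariate homogeneous) resultant of the $n$ homogeneous polynomials $\lambda x_i^{k-1}-(\mathcal{A}x^{k-1})_i$ of degree $k-1$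 in $x_1,\ldots,x_n$. The algebraic multiplicity $\mathrm{am}(\lambda,\mathcal{A})$ is the multiplicity of $\lambda$ as a root of $\varphi_{\mathcal{A}}$. The affine eigenvariety is $\mathcal{V}_\lambda(\mathcal{A})=\{x\in\mathbb{C}^n:\mathcal{A}x^{k-1}=\lambda x^{[k-1]}\}$ and the projective eigenvariety is $\mathbb{V}_\lambda(\mathcal{A})=\{x\in\mathbb{P}^{n-1}:\mathcal{A}x^{k-1}=\lambda x^{[k-1]}\}$, with $\mathbb{P}^{n-1}$ complex projective space. Hypergraphs. A hypergraph $H$ consists of a finite vertex set $V(H)$ and a set $E(H)$ of subsets of $V(H)$ (edges); it is $k$-uniform if every edge has exactly $k$ elements. The degree $d_v$ of a vertex $v$ is the number of edges containing $v$. For a $k$-uniform $H$ on vertices $v_1,\ldots,v_n$, the adjacency tensor $\mathcal{A}(H)$ has order $k$ and dimension $n$, with entry $a_{i_1\ldots i_k}=\frac{1}{(k-1)!}$ if $\{v_{i_1},\ldots,v_{i_k}\}\in E(H)$ and $0$ otherwise. The Laplacian tensor is $\mathcal{L}(H)=\mathcal{D}(H)-\mathcal{A}(H)$, where $\mathcal{D}(H)$ is the diagonal tensor of order $k$ and dimension $n$ whose $(v,v,\ldots,v)$-entry is $d_v$. Zero is always an eigenvalue of $\mathcal{L}(H)$ (with the all-one eigenvector). A hypertree is a connected hypergraph containing no cycles (in the Berge sense: a cycle of length $\ell\ge 2$ is an alternating sequence of distinct vertices and distinct edges $v_1e_1v_2e_2\cdots v_\ell e_\ell v_1$ with $v_i,v_{i+1}\in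 e_i$ and $v_\ell,v_1\in e_\ell$). *)

(* Defs.v *)
From HB Require Import structures.
From mathcomp Require Import all_boot all_order all_algebra.
From mathcomp Require Import classical_sets cardinality reals.
From mathcomp Require Import complex.
From mathcomp Require Import mpoly.
Set Implicit Arguments.
Unset Strict Implicit.
Unset Printing Implicit Defensive.
Import GRing.Theory.
Local Open Scope ring_scope.

Definition tensor (R : Type) (k n : nat) : Type := k.-tuple 'I_n -> R.

(* [tensor_apply A x i] is (A x^{k-1})_i: the sum ranges over the index tuples
   (i, i_2, ..., i_k), and [behead t] is (i_2, ..., i_k).  The vector [x] may
   have coordinates in any commutative ring, in particular x = ('X_1,...,'X_n)
   yields the polynomials themselves. *)
Definition tensor_apply (R : comNzRingType) (k n : nat)
    (A : tensor R k n) (x : 'I_n -> R) (i : 'I_n) : R :=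
  \sum_(t : k.-tuple 'I_n | ohead t == Some i) A t * \prod_(j <- behead t) x j.

Definition diag_tensor (R : nzRingType) (k n : nat) (d : 'I_n -> R) :
    tensor R k n :=
  fun t => \sum_(i < n | t == [tuple of nseq k i]) d i.

Definition monom (n d : nat) : finType := {m : 'X_{1..n < d.+1} | mdeg m == d}.

(* One variable u_{i,m} for each i < n and each monomial m of degree d: the
   coefficients of n generic forms of degree d in n variables. *)
Definition coef_index (n d : nat) : finType := ('I_n * monom n d)%type.
Definition ncoefs (n d : nat) : nat := #|coef_index n d|.

Definition coefs (R : nzRingType) (n d : nat) (F : 'I_n -> {mpoly R[n]}) :
    'I_(ncoefs n d) -> R :=
  fun j => (F (enum_val j).1)@_(val (enum_val j).2).

Definition irreducible_mpoly (C : fieldType) (n : nat) (p : {mpoly C[n]}) :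
    Prop :=
  [/\ p != 0, p \isn't a GRing.unit &
      forall q r : {mpoly C[n]}, p = q * r ->
        q \is a GRing.unit \/ r \is a GRing.unit].

(* Over an algebraically closed field C, and for n, d >= 1, the resultant of n
   forms of degree d in n variables is the unique polynomial in their
   coefficients with these three properties
   (Cox, Little, O'Shea, Using Algebraic Geometry, Chapter 3, Theorem 2.3). *)
Definition is_resultant (C : fieldType) (n d : nat)
    (Res : {mpoly C[ncoefs n d]}) : Prop :=
  [/\ forall F : 'I_n -> {mpoly C[n]}, (forall i, F i \is d.-homog) ->
        (Res.@[coefs F] = 0 <->
         exists2 x : 'rV[C]_n, x != 0 & forall i, (F i).@[x 0] = 0),
      Res.@[coefs (fun i => 'X_i ^+ d)] = 1 &
      irreducible_mpoly Res].

(* The forms lambda * x_i^{k-1} - (A x^{k-1})_i, with lambda the variable of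
   the coefficient ring {poly C}. *)
Definition char_system (C : fieldType) (k n : nat) (A : tensor C k n)
    (i : 'I_n) : {mpoly {poly C}[n]} :=
  ('X : {poly C})%:MP_[n] * 'X_i ^+ k.-1
  - tensor_apply (fun t => (A t)%:P%:MP_[n]) (fun j => 'X_j) i.

Definition tensor_char_poly (C : fieldType) (k n : nat)
    (Res : {mpoly C[ncoefs n k.-1]}) (A : tensor C k n) : {poly C} :=
  mmap polyC (coefs (char_system A)) Res.

Definition alg_mult (C : fieldType) (k n : nat)
    (Res : {mpoly C[ncoefs n k.-1]}) (lambda : C) (A : tensor C k n) : nat :=
  mup lambda (tensor_char_poly Res A).

Definition affine_eigenvariety (C : fieldType) (k n : nat) (lambda : C)
    (A : tensor C k n) : set 'rV[C]_n :=
  [set x | forall i, tensor_apply A (x 0) i = lambda * x 0 i ^+ k.-1]%classic.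

(* A point of the projective space P^{n-1} is a line through the origin of
   C^n; the equations being homogeneous, they hold at this point iff they hold
   all along the line. *)
Definition proj_eigenvariety (C : fieldType) (k n : nat) (lambda : C)
    (A : tensor C k n) : set {vspace 'rV[C]_n} :=
  [set L | \dim L = 1%N /\
     forall x, x \in L -> affine_eigenvariety lambda A x]%classic.

Section AlgebraicSets.
Local Open Scope classical_set_scope.
Variables (C : fieldType) (n : nat).
Implicit Types S Z : set 'rV[C]_n.

Definition zero_locus (I : set {mpoly C[n]}) : set 'rV[C]_n :=
  [set x | forall p, I p -> p.@[x 0] = 0].

Definition algebraic_set S : Prop := exists I, S = zero_locus I.

Definition irreducible_set S : Prop :=
  S !=set0 /\
  forall Z1 Z2, algebraic_set Z1 -> algebraic_set Z2 ->
    S `<=` Z1 `|` Z2 -> S `<=` Z1 \/ S `<=` Z2.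

Definition irreducible_component S Z : Prop :=
  [/\ irreducible_set Z, Z `<=` S &
      forall Z', irreducible_set Z' -> Z `<=` Z' -> Z' `<=` S -> Z' = Z].

Definition irreducible_chain S (d : nat) : Prop :=
  exists Z : nat -> set 'rV[C]_n,
    (forall i, (i <= d)%N ->
       [/\ algebraic_set (Z i), irreducible_set (Z i) & Z i `<=` S]) /\
    (forall i, (i < d)%N -> Z i `<` Z i.+1).

(* Krull dimension.  Chains in C^n have length at most n, so the maximum exists
   unless S is empty. *)
Definition algebraic_dim S : nat :=
  xget 0%N [set d | irreducible_chain S d /\
                    forall d', irreducible_chain S d' -> (d' <= d)%N].

End AlgebraicSets.

Section Hypergraphs.
Variables (V : finType) (E : {set {set V}}).

Definition uniform (k : nat) : Prop := forall e, e \in E -> #|e| = k.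

Definition hdegree (v : V) : nat := #|[set e in E | v \in e]|.

Definition hadj : rel V := fun u v => [exists e in E, (u \in e) && (v \in e)].

Definition hconnected : Prop :=
  (0 < #|V|)%N /\ forall u v : V, connect hadj u v.

(* [ordS] is the cyclic successor on 'I_l, so the last condition includes
   v_l, v_1 \in e_l. *)
Definition berge_cycle (l : nat) (v : 'I_l -> V) (e : 'I_l -> {set V}) : Prop :=
  [/\ (2 <= l)%N, injective v, injective e &
      forall i, [/\ e i \in E, v i \in e i & v (ordS i) \in e i]].

Definition hypertree : Prop :=
  hconnected /\ forall l v e, ~ @berge_cycle l v e.

Variables (C : fieldType) (k : nat).

(* The vertices are numbered by [enum_val : 'I_#|V| -> V]. *)
Definition adjacency_tensor : tensor C k #|V| :=
  fun t => if [set enum_val i | i in t] \in E then ((k.-1)`!)%:R^-1 else 0.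

Definition degree_tensor : tensor C k #|V| :=
  diag_tensor (fun i => (hdegree (enum_val i))%:R).

Definition laplacian_tensor : tensor C k #|V| :=
  fun t => degree_tensor t - adjacency_tensor t.

End Hypergraphs.

Arguments adjacency_tensor {V} E C k t.
Arguments degree_tensor {V} E C k t.
Arguments laplacian_tensor {V} E C k t.

(* Main.v *)
Require Import Defs.
From mathcomp Require Import all_boot all_order all_algebra.
From mathcomp Require Import classical_sets cardinality reals.
From mathcomp Require Import complex.
From mathcomp Require Import mpoly.
From mathcomp Require Import separable boolp filter.
From mathcomp Require Import ring lra zify.
Set Implicit Arguments.
Unset Strict Implicit.
Unset Printing Implicit Defensive.
Import Order.TTheory GRing.Theory Num.Theory.
Local Open Scope ring_scope.

(* Proof idea.  By the maximum principle a nonzero x in V_0(L) has all its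
   coordinates of the same modulus, and x_v^k is the product of x over every
   edge at v; so, normalized by x_{v0} = 1, there are finitely many such points,
   N say, with coordinates among the k-th roots of unity, and V_0(L) is the
   union of N lines.  At each point the Jacobian of the system in the other
   coordinates and lambda is, up to diagonal scalings, the Laplacian matrix of
   a connected graph with one column replaced, and is invertible.

   It remains to see that transversality makes the multiplicity of
   Res(F_0 + lambda x^[k-1]) at lambda = 0 equal to N, using only the
   characterization of Res.
   - At least N: let Q be the leading form, of degree m, of Res at F_0.  If a
     direction W lifts to first order at a zero p, the system F_0 + eps W can be
     corrected by terms of order eps^2 so as to have a zero near p, whence
     Q(W) = 0.  For generic W each p gives a c_p with Q(W + c_p I) = 0, these
     c_p are distinct, and so N <= m <= multiplicity.
   - At most N: Res is irreducible, so for generic systems U, arbitrarily close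
     to F_0, the polynomial Res(U + lambda I) has simple roots.  The roots that
     tend to 0 as U tends to F_0 come with zeros tending to points of V_0(L),
     and by invertibility of the Jacobian at most one of them tends to each
     point. *)

(** * Unique factorization in polynomial rings *)

Definition divides (R : comNzRingType) (a b : R) : Prop := exists c, b = a * c.

Definition prime_elt (R : comUnitRingType) (p : R) : Prop :=
  [/\ p != 0, p \isn't a GRing.unit &
      forall a b, divides p (a * b) -> divides p a \/ divides p b].

Definition prime_product (R : comUnitRingType) (x : R) : Prop :=
  exists (u : R) (s : seq R),
    [/\ u \is a GRing.unit, {in s, forall p, prime_elt p} &
        x = u * \prod_(p <- s) p].

(* Kaplansky's characterization of unique factorization domains. *)
Definition ufd (R : comUnitRingType) : Prop :=
  forall x : R, x != 0 -> prime_product x.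

Section Divides.
Variable R : comNzRingType.
Implicit Types a b c : R.

Lemma divides0 a : divides a 0.
Proof. by exists 0; rewrite mulr0. Qed.

Lemma divides_mulr a b c : divides a b -> divides a (b * c).
Proof. by case=> d ->; exists (d * c); rewrite mulrA. Qed.

Lemma divides_mull a b c : divides a b -> divides a (c * b).
Proof. by move=> /(@divides_mulr _ _ c); rewrite mulrC. Qed.

Lemma divides_add a b c : divides a b -> divides a c -> divides a (b + c).
Proof. by move=> [d ->] [e ->]; exists (d + e); rewrite mulrDr. Qed.

Lemma divides_sub a b c : divides a b -> divides a c -> divides a (b - c).
Proof. by move=> [d ->] [e ->]; exists (d - e); rewrite mulrBr. Qed.

Lemma divides_sum (I : Type) (r : seq I) (P : pred I) (F : I -> R) a :
  (forall i, P i -> divides a (F i)) -> divides a (\sum_(i <- r | P i) F i).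
Proof. by move=> h; apply: big_ind => //; [apply: divides0|apply: divides_add]. Qed.

End Divides.

Lemma prime_product_unit (R : comUnitRingType) (u : R) :
  u \is a GRing.unit -> prime_product u.
Proof. by move=> uu; exists u, [::]; rewrite big_nil mulr1. Qed.

Lemma prime_product_prime (R : comUnitRingType) (p : R) :
  prime_elt p -> prime_product p.
Proof.
move=> pp; exists 1, [:: p]; rewrite big_seq1 mul1r unitr1; split=> // q.
by rewrite inE => /eqP->.
Qed.

Lemma prime_productM (R : comUnitRingType) (x y : R) :
  prime_product x -> prime_product y -> prime_product (x * y).
Proof.
move=> [u [s [uu ps ->]]] [v [t [uv pt ->]]]; exists (u * v), (s ++ t).
rewrite big_cat unitrM uu uv mulrACA; split=> // q.
by rewrite mem_cat => /orP[/ps|/pt].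
Qed.

Section UfdPoly.
Variable R : idomainType.
Implicit Types (p c : R) (f g h : {poly R}).

Lemma divides_polyC p f : divides p%:P f <-> forall i, divides p f`_i.
Proof.
split=> [[g -> i]|h]; first by rewrite coefCM; exists g`_i.
elim/poly_ind: f h => [|f c IH] h; first exact: divides0.
apply: divides_add.
  apply: divides_mulr; apply: IH => i; move: (h i.+1).
  by rewrite coefD coefMX coefC /= addr0.
case: (h 0); rewrite coefD coefMX coefC /= add0r => d ->.
by exists d%:P; rewrite polyCM.
Qed.

Lemma Ndivides_polyC p f : ~ divides p%:P f ->
  exists2 i, ~ divides p f`_i & forall j, (j < i)%N -> divides p f`_j.
Proof.
move=> nf; have ex : exists i, ~~ `[< divides p f`_i >].
  by apply: contrapT => h; apply/nf/divides_polyC => i; apply: contrapT => hi;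
    apply: h; exists i; apply/asboolPn.
case: (ex_minnP ex) => i /asboolPn hi hmin; exists i => // j ji.
by apply: contrapT => /asboolPn /hmin; rewrite leqNgt ji.
Qed.

(** Gauss's lemma. If [f_i] and [g_j] are the first coefficients not divisible by [p], then every
    other term of the coefficient of index [i + j] of [f * g] is divisible by [p], hence so is
    [f_i * g_j]. *)
Lemma prime_polyC p : prime_elt p -> prime_elt p%:P.
Proof.
case=> p0 pU pp; split; first by rewrite polyC_eq0.
  by rewrite poly_unitE coefC size_polyC p0.
move=> f g fg; apply: contrapT => /not_orP[/Ndivides_polyC[i ni hi]].
case/Ndivides_polyC => j nj hj.
have /divides_polyC/(_ (i + j)%N) := fg.
have lt_i : (i < (i + j).+1)%N by rewrite ltnS leq_addr.
rewrite coefM (bigD1 (Ordinal lt_i)) //= addKn => hd.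
suff /pp[] : divides p (f`_i * g`_j) by [].
rewrite -[X in divides p X](addrK (\sum_(l < (i + j).+1 | l != Ordinal lt_i)
  f`_l * g`_(i + j - l))).
apply: divides_sub => //; apply: divides_sum => l.
rewrite -val_eqE /= neq_ltn => /orP[li|il]; first by apply/divides_mulr/hi.
apply/divides_mull/hj; by have := ltn_ord l; lia.
Qed.

Lemma size_scale_const p f : p != 0 -> size (p%:P * f) = size f.
Proof. by move=> p0; rewrite mul_polyC size_scale. Qed.

Hypothesis facR : ufd R.

(** The primes of [c] are removed one at a time: each stays prime as a constant polynomial, so it
    divides [g] or [h]. This turns a factorization up to scalars, that is, over the fraction field,
    into one over [R] with the same degrees. *)
Lemma factor_cancel_scalar c f g h : c != 0 -> c *: f = g * h ->
  exists g' h', [/\ f = g' * h', size g' = size g & size h' = size h].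
Proof.
move=> /[dup] c0 /facR[u [s [uu ps cE]]]; rewrite {c}cE in c0 *.
elim: s ps c0 g h => [|p s IH] ps c0 g h.
  rewrite big_nil mulr1 => e; exists (u^-1 *: g), h; split=> //.
    by rewrite -scalerAl -e scalerA mulVr // scale1r.
  by rewrite size_scale // invr_eq0; move: c0; rewrite big_nil mulr1.
have pp := ps p (mem_head _ _); have [p0 pU _] := pp.
have ps' : {in s, forall q, prime_elt q}.
  by move=> q qs; apply: ps; rewrite inE qs orbT.
move: c0; rewrite big_cons mulrCA => c0; have := c0.
rewrite mulf_eq0 negb_or => /andP[_ c0'] e.
have pP0 : p%:P != 0 :> {poly R} by rewrite polyC_eq0.
have [_ _ /(_ g h) pgh] := prime_polyC pp.
have /pgh[] : divides p%:P (g * h).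
  by exists ((u * \prod_(q <- s) q) *: f); rewrite -e mul_polyC scalerA.
- case=> g' gE; have /(IH ps' c0')[g2 [h2 [fE sg sh]]] :
    (u * \prod_(q <- s) q) *: f = g' * h.
    by apply: (mulfI pP0); rewrite mulrA -gE -e mul_polyC scalerA.
  by exists g2, h2; split=> //; rewrite gE size_scale_const.
- case=> h' hE; have /(IH ps' c0')[g2 [h2 [fE sg sh]]] :
    (u * \prod_(q <- s) q) *: f = g * h'.
    by apply: (mulfI pP0); rewrite mulrCA -hE -e mul_polyC scalerA.
  by exists g2, h2; split=> //; rewrite hE size_scale_const.
Qed.

Definition primitive f := forall p, prime_elt p -> ~ divides p%:P f.

(** Again by induction on the primes of [c]: each divides [h * f], and not [f], which is primitive,
    so it divides [h] and cancels. *)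
Lemma primitive_divides_scalar c f g h :
  primitive f -> c != 0 -> c *: g = h * f -> divides f g.
Proof.
move=> fP /[dup] c0 /facR[u [s [uu ps cE]]]; rewrite {c}cE in c0 *.
elim: s ps c0 h => [|p s IH] ps c0 h.
  rewrite big_nil mulr1 => e; exists (u^-1 *: h).
  by rewrite -scalerAr mulrC -e scalerA mulVr // scale1r.
have pp := ps p (mem_head _ _); have [p0 pU _] := pp.
have ps' : {in s, forall q, prime_elt q}.
  by move=> q qs; apply: ps; rewrite inE qs orbT.
move: c0; rewrite big_cons mulrCA => c0; have := c0.
rewrite mulf_eq0 negb_or => /andP[_ c0'] e.
have pP0 : p%:P != 0 :> {poly R} by rewrite polyC_eq0.
have [_ _ /(_ h f) phf] := prime_polyC pp.
have /phf[[h' hE]|/(fP _ pp)//] : divides p%:P (h * f).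
  by exists ((u * \prod_(q <- s) q) *: g); rewrite -e mul_polyC scalerA.
apply: (IH ps' c0' h').
  by apply: (mulfI pP0); rewrite mulrA -hE -e mul_polyC scalerA.
Qed.

(** The relation [%|] ignores nonzero scalars, so [irreducible_poly] means irreducibility over the
    fraction field. There coprimality yields divisibility of one factor up to a scalar, and
    primitivity removes the scalar. *)
Lemma irreducible_primitive_prime f :
  irreducible_poly f -> primitive f -> prime_elt f.
Proof.
move=> [sf irrf] fP; have f0 : f != 0 by rewrite -size_poly_gt0 ltnW.
split=> //; first by rewrite poly_unitE; case: eqP sf => // ->.
move=> g h [q e].
have dvd x : f %| x -> divides f x.
  case/Pdiv.Idomain.dvdpP => -[c r] /= c0 cx.
  exact: primitive_divides_scalar fP c0 cx.
have fgh : f %| g * h by rewrite e dvdp_mulr.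
have [cop|ncop] := boolP (coprimep f g).
  by right; apply: dvd; rewrite -(Gauss_dvdpr h cop).
left; apply: dvd; apply: dvdp_trans (dvdp_gcdr f g).
by rewrite -(eqp_dvdl _ (irrf _ ncop (dvdp_gcdl _ _))).
Qed.

Lemma divides_prime p q : prime_elt p -> prime_elt q -> divides p q ->
  exists2 w, w \is a GRing.unit & q = p * w.
Proof.
move=> [p0 pU pp] [q0 qU qq] [w qE]; exists w => //.
have [|[v pE]|[v wE]] := qq p w; first by exists 1; rewrite mulr1.
  apply/unitrPr; exists v; apply: (mulfI p0).
  by rewrite mulrA -qE -pE mulr1.
case/negP: pU; apply/unitrPr; exists v; apply: (mulfI q0).
by rewrite mulr1 {2}qE {1}wE mulrCA.
Qed.

Lemma prime_divides_prod p u (s : seq R) : prime_elt p -> u \is a GRing.unit ->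
  divides p (u * \prod_(q <- s) q) -> exists2 q, q \in s & divides p q.
Proof.
move=> [p0 pU pp] uu.
have pu x : x \is a GRing.unit -> divides p x -> False.
  move=> ux [d e]; case/negP: pU; apply/unitrPr; exists (d / x).
  by rewrite mulrA -e divrr.
case/pp => [/(pu _ uu)//|].
elim: s => [|q s IH]; first by rewrite big_nil => /pu; rewrite unitr1; case.
rewrite big_cons => /pp[h|/IH[r rs h]]; first by exists q; rewrite ?mem_head.
by exists r; rewrite // inE rs orbT.
Qed.

(** A prime dividing [f] divides its leading coefficient, which has finitely many prime factors; the
    induction is on their number. *)
Lemma primitive_part f : f != 0 ->
  exists c f0, [/\ c != 0, primitive f0, f = c *: f0 & f0 != 0].
Proof.
move=> f0; have /facR[u [s [uu ps lE]]] : lead_coef f != 0 by rewrite lead_coef_eq0.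
move: {2}(size s) (leqnn (size s)) => n.
elim: n u s f f0 uu ps lE => [|n IH] u s f f0 uu ps lE sn;
  have [fP|/existsNP[p /not_implyP[pp /contrapT[g fE]]]] := pselect (primitive f);
  try by exists 1, f; rewrite oner_eq0 scale1r.
- move: lE; rewrite fE lead_coefM lead_coefC => lE.
  have [] := @prime_divides_prod p u s pp uu; first by exists (lead_coef g); rewrite lE.
  by move: sn; rewrite leqn0 => /nilP ->.
have p0 : p != 0 by case: pp.
have g0 : g != 0 by apply: contraNneq f0 => g0; rewrite fE g0 mulr0.
move: lE; rewrite fE lead_coefM lead_coefC => lE.
have [q qs pq] : exists2 q, q \in s & divides p q.
  by apply: (@prime_divides_prod p u) => //; exists (lead_coef g); rewrite lE.
have [w uw qE] := divides_prime pp (ps _ qs) pq.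
have gE : lead_coef g = (u * w) * \prod_(r <- rem q s) r.
  apply: (mulfI p0); rewrite lE (perm_big _ (perm_to_rem qs)) big_cons /=.
  by rewrite {1}qE; ring.
have uwU : u * w \is a GRing.unit by rewrite unitrM uu.
have prem : {in rem q s, forall r, prime_elt r} by move=> r /mem_rem/ps.
have srem : (size (rem q s) <= n)%N by rewrite size_rem //; case: (s) qs sn.
have [c [h [c0 hP ghE h0]]] := IH (u * w) (rem q s) g g0 uwU prem gE srem.
exists (p * c), h; split; rewrite ?mulf_neq0 //.
by rewrite ghE mul_polyC scalerA.
Qed.

(** Induction on the degree: the content factors in [R], and the primitive part is either
    irreducible over the fraction field, hence prime, or a product of two polynomials of smaller
    degree. *)
Lemma ufd_poly : ufd {poly R}.
Proof.
move=> f; move: {2}(size f) (leqnn (size f)) => n.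
elim: n f => [|n IH] f sf f0; first by move: sf; rewrite leqn0 size_poly_eq0 (negbTE f0).
have primC c : c != 0 -> prime_product c%:P.
  move=> /facR[u [s [uu ps ->]]]; exists u%:P, [seq p%:P | p <- s]; split.
  - by rewrite rmorph_unit.
  - by move=> _ /mapP[p /ps pp ->]; apply: prime_polyC.
  - by rewrite polyCM rmorph_prod big_map.
have [c [g [c0 gP fE g0]]] := primitive_part f0.
rewrite fE -mul_polyC; apply: prime_productM; first exact: primC.
have sg : (size g <= n.+1)%N by rewrite -(size_scale g c0) -fE.
have [s1|s1] := leqP (size g) 1.
  by rewrite (size1_polyC s1); apply: primC; rewrite -polyC_eq0 -size1_polyC.
have [irr|nirr] := pselect (irreducible_poly g).
  exact/prime_product_prime/irreducible_primitive_prime.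
have [q [sq qg nq]] : exists q : {poly R}, [/\ size q != 1, q %| g & ~~ (q %= g)].
  apply: contrapT => h; apply: nirr; split=> // q sq qg.
  by apply: contrapT => /negP nq; apply: h; exists q.
have /Pdiv.Idomain.dvdpP[[a r] /= a0] := qg.
case/(factor_cancel_scalar a0) => q' [r' [gE sr sq']].
have r'0 : q' != 0 by apply: contraNneq g0 => z; rewrite gE z mul0r.
have q'0 : r' != 0 by apply: contraNneq g0 => z; rewrite gE z mulr0.
have lt_q : (size q < size g)%N.
  by rewrite ltn_neqAle (dvdp_size_eqp qg) nq (dvdp_leq g0 qg).
have sgE : size g = (size q' + size r').-1 by rewrite gE size_mul.
have : (0 < size q')%N by rewrite size_poly_gt0.
have : (0 < size r')%N by rewrite size_poly_gt0.
rewrite gE => pq pr; apply: prime_productM; apply: IH => //; lia.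
Qed.

End UfdPoly.

(** * Multivariate polynomials as iterated univariate polynomials *)

Local Notation widen := (widen_ord (leqnSn _)).
Lemma ufd_iso (A B : comUnitRingType) (f : {rmorphism A -> B})
    (g : {rmorphism B -> A}) :
  cancel f g -> cancel g f -> ufd B -> ufd A.
Proof.
move=> fK gK facB x x0; have fx0 : f x != 0.
  by apply: contra x0 => /eqP e; rewrite -(fK x) e rmorph0.
have [u [s [uu ps e]]] := facB _ fx0; exists (g u), [seq g p | p <- s].
rewrite big_map -rmorph_prod -rmorphM -e fK rmorph_unit //.
split=> // _ /mapP[p /ps[p0 pU pp] ->]; split.
- by apply: contra p0 => /eqP e'; rewrite -(gK p) e' rmorph0.
- by apply: contra pU => /(rmorph_unit f); rewrite gK.
have tr y : divides p (f y) -> divides (g p) y.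
  by case=> z ez; exists (g z); rewrite -rmorphM -ez fK.
move=> a b [c abE]; have [] := pp (f a) (f b).
- by exists (f c); rewrite -rmorphM abE rmorphM gK.
- by move/tr; left.
- by move/tr; right.
Qed.

Lemma mpoly_morph_ext (n : nat) (R : nzRingType) (S : nzRingType)
    (f g : {rmorphism {mpoly R[n]} -> S}) :
  (forall c, f c%:MP = g c%:MP) -> (forall i, f 'X_i = g 'X_i) -> f =1 g.
Proof.
move=> eC eX p; rewrite [p]mpolyE !rmorph_sum; apply: eq_bigr => m _.
rewrite -mul_mpolyC !rmorphM eC mpolyXE_id !rmorph_prod; congr (_ * _).
by apply: eq_bigr => i _; rewrite !rmorphXn eX.
Qed.

Lemma muni_widen (n : nat) (R : nzRingType) (i : 'I_n) :
  muni ('X_(widen i) : {mpoly R[n.+1]}) = ('X_i)%:P.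
Proof.
rewrite muniE msuppX big_seq1 mcoeffX eqxx scale1r mnm1E.
rewrite (_ : (widen i == ord_max) = false); last first.
  by apply/negbTE; rewrite -val_eqE /= neq_ltn ltn_ord.
rewrite expr0 alg_polyC; congr ('X_[_])%:P; apply/mnmP => j.
by rewrite !mnmE -val_eqE.
Qed.

Lemma muni_max (n : nat) (R : nzRingType) :
  muni ('X_ord_max : {mpoly R[n.+1]}) = 'X.
Proof.
rewrite muniE msuppX big_seq1 mcoeffX eqxx scale1r mnm1E eqxx expr1.
rewrite (_ : [multinom _ | _ < n] = 0%MM) ?mpolyX0 ?scale1r //.
apply/mnmP => j; rewrite !mnmE; apply/eqP; rewrite eqb0.
by rewrite -val_eqE /= neq_ltn ltn_ord orbT.
Qed.

Section MuniIso.
Variables (n : nat) (R : comNzRingType).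

(** The inverse of [muni]: the univariate variable becomes the last of the [n.+1] variables. *)
Definition mmuni : {rmorphism {poly {mpoly R[n]}} -> {mpoly R[n.+1]}} :=
  horner_eval ('X_ord_max : {mpoly R[n.+1]}) \o map_poly (@mwiden n R).

Lemma mmuniC c : mmuni c%:P = mwiden c.
Proof. by rewrite /= /horner_eval map_polyC hornerC. Qed.

Lemma mmuniX : mmuni 'X = 'X_ord_max.
Proof. by rewrite /= /horner_eval map_polyX hornerX. Qed.

Lemma widen_or_max (i : 'I_n.+1) : (exists j : 'I_n, i = widen j) \/ i = ord_max.
Proof.
have [lt_in|] := ltnP i n; first by left; exists (Ordinal lt_in); apply: val_inj.
by move=> le_ni; right; apply/val_inj/eqP; rewrite eqn_leq le_ni -ltnS ltn_ord.
Qed.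

Lemma muniK : cancel (@muni n R) mmuni.
Proof.
apply: (@mpoly_morph_ext _ _ _ (mmuni \o @muni n R) idfun) => [c|i].
  by change (mmuni (muni c%:MP) = c%:MP); rewrite muniC mmuniC mwidenC.
change (mmuni (muni 'X_i) = 'X_i).
have [[j ->]|->] := widen_or_max i; last by rewrite muni_max mmuniX.
by rewrite muni_widen mmuniC mwidenX mnmwiden1.
Qed.

Lemma mmuniK : cancel mmuni (@muni n R).
Proof.
elim/poly_ind=> [|p c IH]; first by rewrite !rmorph0.
rewrite (rmorphD mmuni) (rmorphM mmuni) muniD muniM mmuniX muni_max IH; congr (_ + _).
rewrite mmuniC; apply: (@mpoly_morph_ext _ _ _ (@muni n R \o @mwiden n R) polyC).
  by move=> a /=; rewrite mwidenC muniC.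
by move=> i /=; rewrite mwidenX mnmwiden1 muni_widen.
Qed.

End MuniIso.

Lemma ufd_mpoly (K : fieldType) (n : nat) : ufd {mpoly K[n]}.
Proof.
elim: n => [|n IH].
  move=> p p0; apply: prime_product_unit.
  have pE : p = (p@_0)%:MP.
    apply/mpolyP => m; rewrite (_ : m = 0%MM) ?mcoeffC ?eqxx ?mulr1 //.
    by apply/mnmP => -[].
  rewrite pE rmorph_unit // unitfE; apply: contraNneq p0 => e.
  by rewrite pE e mpolyC0.
exact: ufd_iso (@muniK n K) (@mmuniK n K) (ufd_poly IH).
Qed.

(** * Points at which a nonzero polynomial does not vanish *)

Lemma poly_neq0_eval (K : numDomainType) (p : {poly K}) :
  p != 0 -> exists t, p.[t] != 0.
Proof.
move=> p0; apply: contrapT => h.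
pose rs : seq K := [seq i%:R | i <- iota 0 (size p)].
have rtp : all (root p) rs.
  by apply/allP => x _; apply/negP => nx; apply: h; exists x; apply/negP.
have urs : uniq rs.
  by rewrite map_inj_uniq ?iota_uniq // => i j /eqP; rewrite eqr_nat => /eqP.
by have := max_poly_roots p0 rtp urs; rewrite size_map size_iota ltnn.
Qed.

(** The first [n] coordinates are chosen so that the leading coefficient in the last variable
    survives; a univariate polynomial remains. *)
Lemma mpoly_neq0_eval (K : numFieldType) (n : nat) (p : {mpoly K[n]}) :
  p != 0 -> exists v, p.@[v] != 0.
Proof.
elim: n p => [|n IH] p p0.
  exists (fun=> 0); apply: contraNneq p0 => e; apply/eqP/mpolyP => m.
  have zE (m' : 'X_{1..0}) : m' = 0%MM by apply/mnmP => -[].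
  move: e; rewrite mevalE; have [mp|/memN_msupp_eq0 ->] := boolP (m \in msupp p).
    rewrite (bigD1_seq m) //= ?msupp_uniq // big_ord0 mulr1 mcoeff0.
    by rewrite [X in _ + X]big1 ?addr0 // => m'; rewrite (zE m) (zE m') eqxx.
  by rewrite mcoeff0.
have : lead_coef (muni p) != 0.
  by rewrite lead_coef_eq0; apply: contra p0 => /eqP e; rewrite -(muniK p) e rmorph0.
case/IH=> v cv; have [t ht] : exists t, (map_poly (meval v) (muni p)).[t] != 0.
  apply: poly_neq0_eval; apply: contra cv => /eqP/polyP/(_ (size (muni p)).-1).
  by rewrite coef_map coef0 => /eqP.
exists (fun i => oapp v t (insub (val i))); congr (_ != 0): ht.
apply: (@mpoly_morph_ext _ _ _
  (horner_eval t \o map_poly (meval v) \o @muni n K)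
  (meval (fun i => oapp v t (insub (val i))))) => [c|i] /=.
  by rewrite muniC map_polyC /= /horner_eval hornerC !mevalC.
have [[j ->]|->] := widen_or_max i.
  by rewrite muni_widen map_polyC /= /horner_eval hornerC !mevalXU /= valK.
by rewrite muni_max map_polyX /horner_eval hornerX mevalXU /= insubF ?ltnn.
Qed.

(** * Resultants of systems of forms *)

Lemma rmorph_mmap (n : nat) (R S T : comNzRingType) (f : {rmorphism R -> S})
    (g : {rmorphism S -> T}) (h : 'I_n -> S) (k : 'I_n -> T)
    (p : {mpoly R[n]}) :
  (forall i, g (h i) = k i) -> g (mmap f h p) = mmap (g \o f) k p.
Proof.
move=> e; rewrite rmorph_sum; apply: eq_bigr => m _; rewrite rmorphM rmorph_prod.
by congr (_ * _); apply: eq_bigr => i _; rewrite rmorphXn e.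
Qed.

Lemma mmap_ext (n : nat) (R S : comNzRingType) (f g : R -> S)
    (h k : 'I_n -> S) (p : {mpoly R[n]}) :
  f =1 g -> h =1 k -> mmap f h p = mmap g k p.
Proof.
move=> e1 e2; apply: eq_bigr => m _; rewrite e1; congr (_ * _).
by apply: eq_bigr => i _; rewrite e2.
Qed.

Lemma size_polyM_le (R : nzRingType) (p q : {poly R}) (a b : nat) :
  (size p <= a.+1)%N -> (size q <= b.+1)%N -> (size (p * q)%R <= (a + b).+1)%N.
Proof. by move=> sp sq; apply: leq_trans (size_polyMleq _ _) _; lia. Qed.

Lemma coefM_top (R : nzRingType) (p q : {poly R}) (a b : nat) :
  (size p <= a.+1)%N -> (size q <= b.+1)%N -> (p * q)`_(a + b) = p`_a * q`_b.
Proof.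
move=> sp sq; have lt_a : (a < (a + b).+1)%N by rewrite ltnS leq_addr.
rewrite coefM (bigD1 (Ordinal lt_a)) //= addKn big1 ?addr0 // => i.
rewrite -val_eqE /= neq_ltn => /orP[ia|ai].
  by rewrite [q`__]nth_default ?mulr0 //; apply: leq_trans sq _; lia.
by rewrite [p`__]nth_default ?mul0r //; apply: leq_trans sp _.
Qed.

(** On the line [a + X b] only the terms [b_j X] of the factors contribute to the top coefficient.
    Applied to [Res] in the direction [I], it gives the leading coefficient [Res(I) = 1]. *)
Lemma mmap_linear_top (n : nat) (R S : comNzRingType) (f : {rmorphism R -> S})
    (a b : 'I_n -> S) (p : {mpoly R[n]}) (D : nat) : p \is D.-homog ->
  let q := mmap (polyC \o f) (fun j => (a j)%:P + b j *: 'X) p in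
  (size q <= D.+1)%N /\ q`_D = mmap f b p.
Proof.
move=> /dhomogP hp /=.
suff main : forall m : 'X_{1..n}, let q := mmap1 (fun j => (a j)%:P + b j *: 'X) m in
    (size q <= (mdeg m).+1)%N /\ q`_(mdeg m) = mmap1 b m.
  split.
    apply: leq_trans (size_sum _ _ _) _; apply/bigmax_leqP_seq => m mp _.
    rewrite mul_polyC; apply: leq_trans (size_scale_leq _ _) _.
    by have [+ _] := main m; have := hp _ mp; rewrite /= => ->.
  rewrite coef_sum /mmap !big_seq; apply: eq_bigr => m mp.
  by rewrite coefCM /=; have [_] := main m; have := hp _ mp; rewrite /= => -> ->.
move=> m /=; rewrite /mmap1 mdegE.
have lin j e : (size (((a j)%:P + b j *: 'X) ^+ e)%R <= e.+1)%N /\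
    (((a j)%:P + b j *: 'X) ^+ e)`_e = b j ^+ e.
  have s2 : (size ((a j)%:P + b j *: 'X)%R <= 2)%N.
    rewrite (leq_trans (size_polyD _ _)) // geq_max.
    rewrite (leq_trans (size_polyC_leq1 _)) //.
    by rewrite (leq_trans (size_scale_leq _ _)) // size_polyX.
  elim: e => [|e [IHs IHc]]; first by rewrite !expr0 size_poly1 coef1.
  rewrite !exprS; split.
    by rewrite -(add1n e); apply: size_polyM_le.
  rewrite -add1n (coefM_top s2 IHs) IHc coefD coefC coefZ coefX /=.
  by rewrite add0r mulr1.
elim/big_rec3: _ => [|j e q r _ [IHs IHc]]; first by rewrite size_poly1 coef1.
have [ls lc] := lin j (m j); split.
  exact: size_polyM_le.
by rewrite (coefM_top ls IHs) IHc lc.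
Qed.

Section Systems.
Variables (C : comNzRingType) (n d : nat).
Local Notation M := (ncoefs n d).

Definition cidx (i : 'I_n) (m : monom n d) : 'I_M := enum_rank (i, m).

(** The ring is arbitrary because coefficients and points will also be polynomials in a parameter,
    or generic coefficients. *)
Definition sys_eval (U : 'I_M -> C) (x : 'I_n -> C) (i : 'I_n) : C :=
  \sum_(m : monom n d) U (cidx i m) * \prod_j x j ^+ (val m) j.

Lemma sys_eval_ext (U U' : 'I_M -> C) (x x' : 'I_n -> C) i :
  U =1 U' -> x =1 x' -> sys_eval U x i = sys_eval U' x' i.
Proof.
move=> eU ex; apply: eq_bigr => m _; rewrite eU; congr (_ * _).
by apply: eq_bigr => j _; rewrite ex.
Qed.

Lemma sys_evalD (U W : 'I_M -> C) x i :
  sys_eval (fun j => U j + W j) x i = sys_eval U x i + sys_eval W x i.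
Proof. by rewrite -big_split; apply: eq_bigr => m _; rewrite mulrDl. Qed.

Lemma sys_evalZ (c : C) (U : 'I_M -> C) x i :
  sys_eval (fun j => c * U j) x i = c * sys_eval U x i.
Proof. by rewrite /sys_eval mulr_sumr; apply: eq_bigr => m _; rewrite mulrA. Qed.

Lemma sys_eval_scale (c : C) (U : 'I_M -> C) x i :
  sys_eval U (fun j => c * x j) i = c ^+ d * sys_eval U x i.
Proof.
rewrite /sys_eval mulr_sumr; apply: eq_bigr => m _; rewrite mulrCA; congr (_ * _).
have cE : c ^+ d = \prod_j c ^+ (val m) j by rewrite prodrXr -mdegE (eqP (valP m)).
by rewrite cE -big_split; apply: eq_bigr => j _; rewrite exprMn.
Qed.

Definition sys_form (U : 'I_M -> C) (i : 'I_n) : {mpoly C[n]} :=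
  \sum_(m : monom n d) U (cidx i m) *: 'X_[val m].

Lemma sys_form_eval U i x : (sys_form U i).@[x] = sys_eval U x i.
Proof.
by rewrite raddf_sum; apply: eq_bigr => m _; rewrite /= mevalZ mevalX.
Qed.

Lemma sys_form_homog U i : sys_form U i \is d.-homog.
Proof.
apply: rpred_sum => m _; apply: rpredZ; rewrite dhomogX; exact: valP m.
Qed.

Lemma coefs_sys_form U : coefs (sys_form U) =1 U.
Proof.
move=> j; rewrite /coefs; case E : (enum_val j) => [i m] /=.
rewrite raddf_sum (bigD1 m) //= mcoeffZ mcoeffX eqxx mulr1 big1 ?addr0.
  by rewrite /cidx -E enum_valK.
move=> m' m'm; rewrite mcoeffZ mcoeffX; case: eqP => [e|]; last by rewrite mulr0.
by case/eqP: m'm; apply/val_inj/val_inj.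
Qed.

Lemma sys_form_coefs (F : 'I_n -> {mpoly C[n]}) i : F i \is d.-homog ->
  sys_form (coefs F) i = F i.
Proof.
move=> hF; apply/mpolyP => m; rewrite raddf_sum /=.
have [dm|dm] := eqVneq (mdeg m) d; last first.
  rewrite (dhomog_nemf_coeff hF dm) big1 // => m' _; rewrite mcoeffZ mcoeffX.
  case: eqP => [e|]; last by rewrite mulr0.
  by case/eqP: dm; rewrite -e; apply/eqP/(valP m').
have lt_m : (mdeg m < d.+1)%N by rewrite dm.
pose m' : monom n d := exist _ (BMultinom lt_m) (introT eqP dm).
rewrite (bigD1 m') //= mcoeffZ mcoeffX eqxx mulr1 big1 ?addr0.
  by rewrite /coefs /cidx enum_rankK.
move=> m2 m2m; rewrite mcoeffZ mcoeffX; case: eqP => [e|]; last by rewrite mulr0.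
by case/eqP: m2m; apply/val_inj/val_inj.
Qed.

Lemma coefs_eval (F : 'I_n -> {mpoly C[n]}) x i : F i \is d.-homog ->
  sys_eval (coefs F) x i = (F i).@[x].
Proof. by move=> hF; rewrite -sys_form_eval sys_form_coefs. Qed.

Definition sys_pow : 'I_M -> C := coefs (fun i => 'X_i ^+ d).

Lemma sys_pow_eval x i : sys_eval sys_pow x i = x i ^+ d.
Proof.
rewrite coefs_eval ?rmorphXn /= ?mevalXU //.
by rewrite -[X in X.-homog]mul1n; apply: dhomogMn; rewrite dhomogX /= mdeg1.
Qed.

End Systems.

Lemma rmorph_sys_eval (B C : comNzRingType) (f : {rmorphism B -> C}) (n d : nat)
    (U : 'I_(ncoefs n d) -> B) x i :
  f (sys_eval U x i) = sys_eval (f \o U) (f \o x) i.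
Proof.
rewrite rmorph_sum; apply: eq_bigr => m _; rewrite rmorphM rmorph_prod.
by congr (_ * _); apply: eq_bigr => j _; rewrite rmorphXn.
Qed.

(** * The resultant on lines in the direction [I] of the system of powers *)

Section Resultant.
Variables (C : numClosedFieldType) (n d : nat).
Local Notation M := (ncoefs n d).
Local Notation A := {mpoly C[M]}.
Variable Res : A.
Hypothesis hRes : is_resultant Res.
Hypothesis n_gt0 : (0 < n)%N.
Local Notation I := (@sys_pow C n d).
Implicit Types U W : 'I_M -> C.

Lemma system_resultant_eq0 U : Res.@[U] = 0 <->
  exists2 x : 'I_n -> C, (exists i, x i != 0) & forall i, sys_eval U x i = 0.
Proof.
have [/(_ (sys_form U) (@sys_form_homog _ _ _ U)) + _ _] := hRes.
rewrite (meval_eq _ (coefs_sys_form U)) => ->; split=> [[x x0 xU]|[x [i x0] xU]].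
  exists (x 0) => [|i]; last by rewrite -sys_form_eval.
  apply: contrapT => h; case/eqP: x0; apply/rowP => i; rewrite mxE.
  by apply: contrapT => /eqP xi; apply: h; exists i.
exists (\row_j x j) => [|j].
  by apply: contraNneq x0 => /rowP/(_ i); rewrite !mxE => ->.
by rewrite (meval_eq _ (v2 := x)) ?sys_form_eval // => l; rewrite mxE.
Qed.

Lemma resultant_pow : Res.@[I] = 1.
Proof. by have [_ + _] := hRes. Qed.

Lemma resultant_neq0 : Res != 0.
Proof. by apply: contra_eq_neq resultant_pow => ->; rewrite meval0 eq_sym oner_eq0. Qed.

Lemma meval_scale_homog D (p : A) (t : C) U : p \is D.-homog ->
  p.@[fun j => t * U j] = t ^+ D * p.@[U].
Proof.
move=> /dhomogP hp; rewrite !mevalE mulr_sumr !big_seq; apply: eq_bigr => m mp.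
rewrite mulrCA; congr (_ * _).
have cE : t ^+ D = \prod_j t ^+ m j by rewrite prodrXr -mdegE -(hp _ mp).
by rewrite cE -big_split; apply: eq_bigr => j _; rewrite exprMn.
Qed.

(* The vanishing locus is a cone: for [Res U != 0] the polynomial [Res (t U)]
   of the variable [t] has no root but 0, so it is a monomial. *)
Lemma resultant_homog : exists D, Res \is D.-homog.
Proof.
pose k := mmeasure mdeg Res; have part := @pihomog_partitionE M C mdeg k Res (leqnn _).
have [/existsP[j /eqP jne] | none] := boolP [exists j : 'I_k, pihomog mdeg j Res != 0];
    last first.
  move: resultant_neq0; rewrite part big1 ?eqxx // => j _.
  by apply/eqP; apply: contraNT none => h; apply/existsP; exists j.
exists j; rewrite part; apply: rpred_sum => i _.
have [->|ij] := eqVneq i j; first exact: pihomogP.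
suff -> : pihomog mdeg i Res = 0 by exact: rpred0.
apply/eqP; apply: contrapT => /negP i0.
(* At a point [U] where two components and [Res] are nonzero, [q] below has two nonzero
   coefficients, since its coefficients are the values at [U] of the components; this contradicts
   its being a monomial. *)
have : pihomog mdeg i Res * pihomog mdeg j Res * Res != 0.
  by rewrite !mulf_neq0 ?resultant_neq0 //; apply/eqP.
case/mpoly_neq0_eval => U; rewrite !mevalM !mulf_eq0 !negb_or => /andP[/andP[ui uj] uR].
pose q : {poly C} := \poly_(l < k) (pihomog mdeg l Res).@[U].
have qE t : q.[t] = Res.@[fun l => t * U l].
  rewrite [in RHS]part raddf_sum horner_poly; apply: eq_bigr => l _ /=.
  by rewrite (meval_scale_homog _ _ (pihomogP _ _ _)) mulrC.
have q0 : q != 0.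
  apply: contraNneq uR => q0; have := qE 1; rewrite q0 horner0 => e.
  by rewrite -(meval_eq _ (v1 := fun l => 1 * U l)) -?e // => l; rewrite mul1r.
have qroot t : t != 0 -> q.[t] != 0.
  move=> t0; apply: contra uR; rewrite qE => /eqP/system_resultant_eq0[x x0 xU].
  apply/eqP/system_resultant_eq0; exists x => // v; apply: (mulfI t0).
  by rewrite -sys_evalZ xU mulr0.
have [r qr] := closed_field_poly_normal q.
have rE : r = nseq (size r) 0.
  apply/all_pred1P/allP => z zr /=; apply: contraT => /qroot.
  rewrite qr hornerZ horner_prod (big_rem z) //= hornerXsubC subrr mul0r mulr0.
  by rewrite eqxx.
have qX : q = lead_coef q *: 'X^(size r).
  by rewrite {1}qr {1}rE big_nseq iter_mulr_1 subr0.
have ql (l : 'I_k) : (pihomog mdeg l Res).@[U] != 0 -> val l = size r.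
  move=> ul; have : q`_l != 0 by rewrite coef_poly ltn_ord.
  rewrite qX coefZ coefXn => h; apply/eqP.
  by apply: contraNT h => /negbTE /= ->; rewrite mulr0.
by case/eqP: ij; apply: val_inj; rewrite ql // ql.
Qed.

(** At [U = tensor_coefs A] this is the characteristic polynomial of the tensor [A]
    ([tensor_char_polyE]). *)
Definition res_line (U : 'I_M -> C) : {poly C} :=
  mmap polyC (fun j => (U j)%:P + I j *: 'X) Res.

Definition res_lineU : {poly A} :=
  mmap (polyC \o mpolyC M (R:=C)) (fun j => ('X_j)%:P + (I j)%:MP *: 'X) Res.

Lemma res_lineU_eval U : map_poly (meval U) res_lineU = res_line U.
Proof.
rewrite (@rmorph_mmap _ _ _ _ _ _ _ (fun j => (U j)%:P + I j *: 'X)).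
  by apply: mmap_ext => // c /=; rewrite map_polyC /= mevalC.
move=> j; rewrite rmorphD /= map_polyC /= mevalXU; congr (_ + _).
by rewrite map_polyZ /= mevalC map_polyX.
Qed.

Lemma horner_res_line U t : (res_line U).[t] = Res.@[fun j => U j + t * I j].
Proof.
rewrite -[LHS]/(horner_eval t _).
rewrite (@rmorph_mmap _ _ _ _ _ _ _ (fun j => U j + t * I j)).
  by apply: mmap_ext => // c /=; rewrite /horner_eval hornerC.
by move=> j; rewrite /= /horner_eval hornerD hornerC hornerZ hornerX mulrC.
Qed.

(* Shearing along [I] is an automorphism, so [res_lineU] inherits the
   irreducibility of [Res]. *)
Definition shear_coef (s : C) : {rmorphism A -> {poly A}} :=
  mmap (polyC \o mpolyC M (R:=C)) (fun j => ('X_j)%:P + (s * I j)%:MP *: 'X).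

Definition shear (s : C) : {rmorphism {poly A} -> {poly A}} :=
  horner_eval ('X : {poly A}) \o map_poly (shear_coef s).

Lemma shear_coefC s c : shear_coef s c%:MP = c%:MP%:P.
Proof. by rewrite /= mmapC. Qed.

Lemma shear_coefX s j : shear_coef s 'X_j = ('X_j)%:P + (s * I j)%:MP *: 'X.
Proof. by rewrite /= mmapX mmap1U. Qed.

Lemma shearC s c : shear s c%:P = shear_coef s c.
Proof. by rewrite /= /horner_eval map_polyC hornerC. Qed.

Lemma shearX s : shear s 'X = 'X.
Proof. by rewrite /= /horner_eval map_polyX hornerX. Qed.

Lemma shearZ s c p : shear s (c *: p) = shear_coef s c * shear s p.
Proof. by rewrite -mul_polyC rmorphM shearC. Qed.

Lemma res_lineUE : res_lineU = shear 1 Res%:P.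
Proof. by rewrite shearC; apply: mmap_ext => // j; rewrite mul1r. Qed.

(* Keeps unification from unfolding the two morphisms. *)
Local Opaque shear shear_coef.

Lemma shearK s p : shear (- s) (shear s p) = p.
Proof.
elim/poly_ind: p => [|p c IH]; first by rewrite !rmorph0.
have h t x y : shear t (x * 'X + y) = shear t x * 'X + shear t y.
  by rewrite rmorphD rmorphM shearX.
rewrite h h shearC; congr (_ * 'X + _); first exact: IH.
apply: (@mpoly_morph_ext _ _ _ (shear (- s) \o shear_coef s) polyC) => [a|j].
  change (shear (- s) (shear_coef s a%:MP) = a%:MP%:P).
  by rewrite shear_coefC shearC shear_coefC.
change (shear (- s) (shear_coef s 'X_j) = ('X_j)%:P).
rewrite shear_coefX (rmorphD (shear (- s))) shearC shear_coefX shearZ shearX.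
rewrite shear_coefC mul_polyC -addrA -scalerDl -mpolyCD mulNr addNr.
by rewrite mpolyC0 scale0r addr0.
Qed.

Lemma res_lineU_irreducible p q : res_lineU = p * q ->
  p \is a GRing.unit \/ q \is a GRing.unit.
Proof.
rewrite res_lineUE => e.
have back r : exists2 r', r' = shear (- 1) r & r = shear 1 r'.
  by exists (shear (- 1) r) => //; have := shearK (- 1) r; rewrite opprK.
have [[p' p'E pE] [q' q'E qE]] := (back p, back q).
have e' : Res%:P = p' * q' by rewrite p'E q'E -rmorphM -e shearK.
rewrite {}pE {}qE {p q back e p'E q'E}.
have : size (p' * q') == 1%N by rewrite -e' size_polyC resultant_neq0.
rewrite size_mul_eq1 => /andP[sp sq].
have /size_poly1P[a a0 pE] := sp; have /size_poly1P[b b0 qE] := sq.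
have /polyC_inj RE : Res%:P = (a * b)%:P by rewrite polyCM -pE -qE.
have [_ _ [_ _ /(_ _ _ RE)[aU|bU]]] := hRes; [left|right].
  by rewrite pE; apply/rmorph_unit/rmorph_unit.
by rewrite qE; apply/rmorph_unit/rmorph_unit.
Qed.

Lemma res_lineU_size : exists D, [/\ (0 < D)%N, size res_lineU = D.+1 &
  lead_coef res_lineU = 1].
Proof.
have [D hD] := resultant_homog; exists D.
have [] := mmap_linear_top (@mpolyC M C) (fun j => 'X_j) (fun j => (I j)%:MP) hD.
rewrite -/res_lineU => sz top.
have top1 : res_lineU`_D = 1.
  rewrite top -mpolyC1 -resultant_pow /meval (@rmorph_mmap _ _ _ _ _ (@mpolyC M C) _
      (fun j => (I j)%:MP)) //.
have szE : size res_lineU = D.+1.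
  apply/eqP; rewrite eqn_leq sz ltnNge; apply/negP => h.
  by move: top1; rewrite nth_default // => /eqP; rewrite eq_sym oner_eq0.
split=> //; last by rewrite lead_coefE szE.
(* In degree 0, [Res] would take the same value at the zero system, of which every point is a zero,
   and at [I], where it is 1. *)
rewrite lt0n; apply: contraTneq isT => D0.
have R0 : Res.@[fun=> 0] = 0.
  apply/system_resultant_eq0; exists (fun=> 1) => [|i];
      first by exists (Ordinal n_gt0); rewrite oner_eq0.
  by rewrite /sys_eval big1 // => m _; rewrite mul0r.
have := meval_scale_homog 0 I hD; rewrite D0 expr0 mul1r resultant_pow.
rewrite (meval_eq _ (v2 := fun=> 0)) => [|j]; last by rewrite mul0r.
by rewrite R0 => /eqP; rewrite eq_sym oner_eq0.
Qed.

Lemma res_line_size : exists D, forall U,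
  size (res_line U) = D.+1 /\ lead_coef (res_line U) = 1.
Proof.
have [D [_ sz lc]] := res_lineU_size; exists D => U.
have lU : meval U (lead_coef res_lineU) != 0 by rewrite lc rmorph1 oner_eq0.
rewrite -res_lineU_eval size_map_poly_id0 // sz; split=> //.
by rewrite lead_coef_map_id0 ?rmorph0 // lc rmorph1.
Qed.

(** The gcd with the derivative divides [res_lineU] up to a scalar, and unique factorization makes
    this an honest factorization. If the gcd is not constant, irreducibility gives it the full
    degree, but it divides the derivative, which is nonzero in characteristic 0 and of smaller
    degree. *)
Lemma res_lineU_coprime : coprimep res_lineU res_lineU^`().
Proof.
have [D [D0 sz lc]] := res_lineU_size.
have P0 : res_lineU != 0 by rewrite -size_poly_gt0 sz.
have P'0 : res_lineU^`() != 0.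
  apply: contraTneq isT => /polyP/(_ D.-1); rewrite coef_deriv coef0 prednK //.
  have -> : res_lineU`_D = 1 by rewrite -lc lead_coefE sz.
  move=> /eqP.
  rewrite -mpolyC1 -mpolyCMn mpolyC_eq0 pnatr_eq0 => /eqP h.
  by rewrite h in D0.
set g := gcdp res_lineU res_lineU^`().
apply: contraT; rewrite coprimep_def -/g => sg.
have /Pdiv.Idomain.dvdpP[[c q] /= c0] : g %| res_lineU by apply: dvdp_gcdl.
case/(factor_cancel_scalar (@ufd_mpoly C M) c0) => q' [g' [e sq' sg']].
case: (res_lineU_irreducible e); rewrite poly_unitE => /andP[/eqP s1 _]; last first.
  by rewrite -sg' s1 eqxx in sg.
have szg : size res_lineU = size g.
  have : q' * g' != 0 by rewrite -e.
  by rewrite mulf_eq0 negb_or => /andP[q0 g0]; rewrite e size_mul // s1 sg'.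
have : (size g <= size res_lineU^`())%N by apply: dvdp_leq => //; apply: dvdp_gcdr.
by rewrite -szg leqNgt lt_size_deriv.
Qed.

(* Irreducibility of [Res] enters only here: on a generic line in the
   direction [I] the resultant has simple roots. *)
Lemma res_line_separable : exists2 D : A, D != 0 &
  forall U, D.@[U] != 0 -> separable.separable_poly (res_line U).
Proof.
(* [D] is the constant in a Bezout identity between the generic polynomial and its derivative; the
   identity specializes to every [U], and its right-hand side remains a nonzero constant when
   [D.@[U] != 0]. *)
have /Bezout_coprimepP[[u v] /=] := res_lineU_coprime.
rewrite -size_poly_eq1 => /size_poly1P[D D0 e]; exists D => // U DU.
rewrite unlock; apply/Bezout_coprimepP; exists (map_poly (meval U) u,
    map_poly (meval U) v) => /=.
rewrite -res_lineU_eval deriv_map -!rmorphM -rmorphD.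
have -> : u * res_lineU + v * res_lineU^`() = D%:P := e.
by rewrite /= map_polyC polyC_eqp1.
Qed.
End Resultant.

(** * Limits along an ultrafilter *)

Section UltraLimit.
Variables (C : numFieldType) (F : set_system nat).
Hypothesis ultraF : UltraFilter F.
Local Open Scope classical_set_scope.

Let properF : ProperFilter F := @ultra_proper _ _ ultraF.
Local Existing Instance properF.

(** Along an ultrafilter every bounded sequence converges ([ulim_bounded]), which replaces the
    repeated extraction of subsequences. *)
Definition ulim (z : nat -> C) (c : C) : Prop :=
  forall e : C, 0 < e -> F [set j | `|z j - c| < e].

Lemma ulim_cst c : ulim (fun=> c) c.
Proof.
by move=> e e0; apply: filterS filterT => j _ /=; rewrite subrr normr0.
Qed.

Lemma ulim_near (z w : nat -> C) c : F [set j | z j = w j] -> ulim z c -> ulim w c.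
Proof.
move=> h hz e e0; apply: filterS (filterI h (hz e e0)).
by move=> j [/= <-].
Qed.

Lemma ulim_ext (z w : nat -> C) c : z =1 w -> ulim z c -> ulim w c.
Proof. by move=> h; apply: ulim_near; apply: filterS filterT => j _; apply: h. Qed.

Lemma ulimD (z w : nat -> C) a b :
  ulim z a -> ulim w b -> ulim (fun j => z j + w j) (a + b).
Proof.
move=> hz hw e e0; have e2 : 0 < e / 2 by rewrite divr_gt0.
apply: filterS (filterI (hz _ e2) (hw _ e2)) => j [/= h1 h2].
rewrite opprD addrACA (le_lt_trans (ler_normD _ _)) //.
by rewrite (splitr e) ltrD.
Qed.

Lemma ulimM (z w : nat -> C) a b :
  ulim z a -> ulim w b -> ulim (fun j => z j * w j) (a * b).
Proof.
move=> hz hw e e0.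
pose A := 1 + `|a|; pose B := 1 + `|b|.
have A0 : 0 < A by rewrite ltr_pwDl.
have B0 : 0 < B by rewrite ltr_pwDl.
have e1 : 0 < e / 2 / B by rewrite !divr_gt0.
have e2 : 0 < e / 2 / A by rewrite !divr_gt0.
apply: filterS (filterI (filterI (hz _ e1) (hz _ ltr01)) (hw _ e2)) => j [[/= h1 h2] h3].
have -> : z j * w j - a * b = z j * (w j - b) + (z j - a) * b by ring.
rewrite (le_lt_trans (ler_normD _ _)) // (splitr e) ler_ltD ?normrM //.
  have zA : `|z j| <= A.
    rewrite -[z j](subrK a) (le_trans (ler_normD _ _)) // lerD2r.
    exact: ltW.
  apply: le_trans (ler_pM _ _ zA (ltW h3)) _ => //.
  by rewrite mulrC divfK ?gt_eqF.
apply: le_lt_trans (ler_wpM2l _ (_ : `|b| <= B)) _ => //.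
  by rewrite lerDr.
by rewrite -ltr_pdivlMr.
Qed.

Lemma ulim_unique (z : nat -> C) a b : ulim z a -> ulim z b -> a = b.
Proof.
move=> ha hb; apply/eqP; rewrite -subr_eq0; apply: contraT => ab.
have e0 : 0 < `|a - b| / 2 by rewrite divr_gt0 // normr_gt0.
have [j [/= h1 h2]] := filter_ex (filterI (ha _ e0) (hb _ e0)).
have : `|a - b| < `|a - b|.
  rewrite {1}(_ : a - b = (a - z j) + (z j - b)); last by ring.
  rewrite (le_lt_trans (ler_normD _ _)) // [X in _ < X]splitr ltrD //.
  by rewrite distrC.
by rewrite ltxx.
Qed.

Lemma ulim_neq0 (z : nat -> C) a : ulim z a -> a != 0 -> F [set j | z j != 0].
Proof.
move=> hz a0; have := hz `|a|; rewrite normr_gt0 a0 => /(_ isT).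
move=> h; apply: filterS h => j /= h; apply/eqP => zj; move: h.
by rewrite zj sub0r normrN ltxx.
Qed.

Lemma ulimV (z : nat -> C) a : a != 0 -> ulim z a -> ulim (fun j => (z j)^-1) a^-1.
Proof.
move=> a0 hz e e0.
have na : 0 < `|a| by rewrite normr_gt0.
have h2 : 0 < `|a| / 2 by rewrite divr_gt0.
have h3 : 0 < e * (`|a| / 2 * `|a|) by rewrite mulr_gt0 // mulr_gt0.
apply: filterS (filterI (hz _ h2) (hz _ h3)) => j [/= l1 l2].
have zj : `|a| / 2 < `|z j|.
  have := ler_normD (z j) (a - z j); rewrite addrC subrK [`|a - _|]distrC => h.
  have : `|a| < `|z j| + `|a| / 2 by rewrite (le_lt_trans h) // ltrD2l.
  by rewrite -ltrBlDr {1}(splitr `|a|) addrK.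
have z0 : z j != 0 by rewrite -normr_gt0 (lt_trans h2).
have -> : (z j)^-1 - a^-1 = (a - z j) / (z j * a) by field; rewrite a0 z0.
rewrite normrM normfV ltr_pdivrMr ?normr_gt0 ?mulf_neq0 // distrC.
by rewrite (lt_trans l2) // ltr_pM2l // normrM ltr_pM2r.
Qed.

Lemma ulim_sum (I : Type) (r : seq I) (P : pred I) (z : I -> nat -> C) a :
  (forall i, P i -> ulim (z i) (a i)) ->
  ulim (fun j => \sum_(i <- r | P i) z i j) (\sum_(i <- r | P i) a i).
Proof.
move=> h; elim: r => [|i r IH].
  by rewrite big_nil; apply: ulim_ext (ulim_cst _) => j; rewrite big_nil.
rewrite big_cons; case: ifP => Pi; last first.
  by apply: ulim_ext IH => j; rewrite big_cons Pi.
by apply: ulim_ext (ulimD (h i Pi) IH) => j; rewrite big_cons Pi.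
Qed.

Lemma ulim_prod (I : Type) (r : seq I) (P : pred I) (z : I -> nat -> C) a :
  (forall i, P i -> ulim (z i) (a i)) ->
  ulim (fun j => \prod_(i <- r | P i) z i j) (\prod_(i <- r | P i) a i).
Proof.
move=> h; elim: r => [|i r IH].
  by rewrite big_nil; apply: ulim_ext (ulim_cst _) => j; rewrite big_nil.
rewrite big_cons; case: ifP => Pi; last first.
  by apply: ulim_ext IH => j; rewrite big_cons Pi.
by apply: ulim_ext (ulimM (h i Pi) IH) => j; rewrite big_cons Pi.
Qed.

Lemma ulimN (z : nat -> C) a : ulim z a -> ulim (fun j => - z j) (- a).
Proof.
move=> hz; rewrite -mulN1r; apply: ulim_ext (ulimM (ulim_cst (-1)) hz) => j.
by rewrite mulN1r.
Qed.

Lemma ulimB (z w : nat -> C) a b :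
  ulim z a -> ulim w b -> ulim (fun j => z j - w j) (a - b).
Proof. by move=> hz hw; apply: ulimD => //; apply: ulimN. Qed.

Lemma ulimX (z : nat -> C) a n : ulim z a -> ulim (fun j => z j ^+ n) (a ^+ n).
Proof.
move=> hz; elim: n => [|n IH]; first exact: ulim_cst.
by rewrite exprS; apply: ulim_ext (ulimM hz IH) => j; rewrite exprS.
Qed.

Lemma ulim_meval (n : nat) (p : {mpoly C[n]}) (z : 'I_n -> nat -> C) a :
  (forall i, ulim (z i) (a i)) -> ulim (fun j => p.@[z^~ j]) p.@[a].
Proof.
move=> h; rewrite mevalE; apply: ulim_ext (_ : ulim (fun j =>
  \sum_(m <- msupp p) p@_m * \prod_i z i j ^+ m i) _) => [j|]; first by rewrite mevalE.
apply: ulim_sum => m _; apply: ulimM; first exact: ulim_cst.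
by apply: ulim_prod => i _; apply: ulimX.
Qed.

Lemma ulim_det (n : nat) (B : nat -> 'M[C]_n) (A : 'M[C]_n) :
  (forall i l, ulim (fun j => B j i l) (A i l)) ->
  ulim (fun j => \det (B j)) (\det A).
Proof.
move=> h; apply: ulim_sum => s _; apply: ulimM; first exact: ulim_cst.
by apply: ulim_prod => i _.
Qed.

End UltraLimit.

Lemma ulim_invS (R : realType) (F : set_system nat) (ultraF : UltraFilter F) :
  (forall N, F [set j | (N <= j)%N]%classic) ->
  ulim F (fun j => j.+1%:R^-1 : R[i]) 0.
Proof.
have properF : ProperFilter F := @ultra_proper _ _ ultraF.
move=> hF e; rewrite ltcE /= => /andP[/eqP ime ree].
pose N := Num.bound (complex.Re e)^-1.
apply: filterS (hF N) => j /= Nj.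
have lt_Nj : (complex.Re e)^-1 < j.+1%:R.
  apply: lt_le_trans (archi_boundP _) _; first by rewrite invr_ge0 ltW.
  by rewrite ler_nat -/N leqW.
have eE : e = (complex.Re e)%:C%C by rewrite [LHS]complexE ime mulr0 addr0.
rewrite subr0 normfV normr_nat eE -(rmorph_nat (real_complex R)) -fmorphV ltcR.
by rewrite -[X in _ < X]invrK ltf_pV2 // posrE ?invr_gt0 // ltr0n.
Qed.

(** A real sequence converges to the supremum of the numbers that lie below [F]-almost all its
    terms: for each [e > 0] the ultrafilter decides on which side of [sup S + e] the terms lie.
    Complex sequences are treated by real and imaginary parts. *)
Lemma ulim_bounded (R : realType) (F : set_system nat) (ultraF : UltraFilter F)
    (z : nat -> R[i]) (B : R[i]) :
  F [set j | `|z j| <= B]%classic -> exists c, ulim F z c.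
Proof.
have properF : ProperFilter F := @ultra_proper _ _ ultraF.
suff every (w : nat -> R[i]) : (forall j, `|w j| <= B) -> exists c, ulim F w c.
  move=> hB; have [j0 /= /(le_trans (normr_ge0 _)) B0] := filter_ex hB.
  have [j|c hc] := every (fun j => if `|z j| <= B then z j else 0).
    by case: ifP => // _; rewrite normr0.
  by exists c; apply: ulim_near hc => //; apply: filterS hB => j /= ->.
have real_case (u : nat -> R) b : (forall j, `|u j| <= b) ->
    exists s, ulim F u s.
  move=> hb; pose S : set R := [set r | F [set j | r <= u j]]%classic.
  have S0 : S (- b).
    by apply: filterS filterT => j _ /=; have := hb j; rewrite ler_norml => /andP[].
  have Sub : (ubound S b)%classic.
    move=> r /filter_ex[j /= rj]; apply: le_trans rj _.
    exact: le_trans (ler_norm _) (hb j).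
  have hs : has_sup S by split; [exists (- b)|exists b].
  exists (sup S) => e e0.
  have [r Sr rs] := sup_adherent e0 hs.
  have [h|h] := in_ultra_setVsetC [set j | sup S + e <= u j]%classic ultraF.
    have := ub_le_sup (ex_intro _ b Sub) h.
    by rewrite gerDl leNgt e0.
  apply: filterS (filterI Sr h) => j [/= rj /negP]; rewrite -ltNge => uj.
  by rewrite ltr_norml; apply/andP; split; lra.
move=> {z} hB; rename w into z.
have embed u s : ulim F u s -> ulim F (fun j => (u j)%:C%C) (s%:C%C : R[i]).
  move=> hu e; rewrite ltcE /= => /andP[/eqP ime ree].
  apply: filterS (hu _ ree) => j /= hj.
  rewrite -rmorphB normc_def /= ltcE /= ime eqxx /=.
  by rewrite expr0n addr0 sqrtr_sqr.
have Re0 (w : R[i]) : `|complex.Re w|%:C%C <= `|w| := normc_ge_Re w.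
have Im0 (w : R[i]) : `|complex.Im w|%:C%C <= `|w|.
  have := normc_ge_Re (w * 'i%C); rewrite ReiNIm normrN normrM.
  by rewrite [`|'i%C|]normc_def /= expr0n expr1n add0r sqrtr1 mulr1.
have bB (x : R) j : x%:C%C <= `|z j| -> x <= complex.Re B.
  by move=> h; have := le_trans h (hB j); rewrite lecE => /andP[].
have [s hs] := real_case (fun j => complex.Re (z j)) (complex.Re B) (fun j =>
    bB _ _ (Re0 (z j))).
have [t ht] := real_case (fun j => complex.Im (z j)) (complex.Re B) (fun j =>
    bB _ _ (Im0 (z j))).
exists (s%:C%C + 'i%C * t%:C%C).
apply: ulim_ext (ulimD ultraF (embed _ _ hs) (ulimM ultraF (ulim_cst ultraF 'i%C)
    (embed _ _ ht))).
by move=> j /=; rewrite -complexE.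
Qed.

(** * Multiplicity of a root of the resultant: lower bound *)

Lemma mpoly_ring_ind (n : nat) (R : nzRingType) (P : {mpoly R[n]} -> Prop) :
  (forall c, P c%:MP) -> (forall i, P 'X_i) ->
  (forall p q, P p -> P q -> P (p + q)) ->
  (forall p q, P p -> P q -> P (p * q)) -> forall p, P p.
Proof.
move=> hC hX hD hM p; rewrite [p]mpolyE; apply: big_ind => // [|m _].
  by rewrite -mpolyC0.
rewrite -mul_mpolyC mpolyXE_id; apply: (hM) => //.
apply: big_ind => // [|i _]; first by rewrite -mpolyC1.
by elim: (m i) => [|e IH]; rewrite ?expr0 -?mpolyC1 // exprS; apply: hM.
Qed.

(** First-order Taylor expansion along the line [p + X w]; such expansions are stable under sums and
    products, whence the induction on the construction of [f]. *)
Lemma mmap_taylor (C : comNzRingType) (n : nat) (p w : 'I_n -> C) :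
  forall f : {mpoly C[n]}, exists q, mmap polyC (fun u => (p u)%:P + w u *: 'X) f =
    (f.@[p])%:P + (\sum_u (f^`M(u)).@[p] * w u) *: 'X + 'X^2 * q.
Proof.
set x : 'I_n -> {poly C} := fun u => _.
elim/mpoly_ring_ind => [c|i|f g [q eq] [r er]|f g [q eq] [r er]].
- exists 0; rewrite mmapC mevalC big1 ?scale0r ?mulr0 ?addr0 // => u _.
  by rewrite mderivC meval0 mul0r.
- exists 0; rewrite mmapX mmap1U mevalXU mulr0 addr0 /x; congr (_ + _ *: _).
  rewrite (bigD1 i) //= big1 ?addr0 => [|u ui].
    rewrite mderivX mnm1E eqxx scale1r (_ : (U_(i) - U_(i) = 0)%MM) ?mpolyX0.
      by rewrite meval1 mul1r.
    by apply/mnmP => l; rewrite mnmBE mnm0E subnn.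
  by rewrite mderivX mnm1E eq_sym (negbTE ui) scale0r meval0 mul0r.
- exists (q + r); rewrite !raddfD /= [mmap _ _ f]eq [mmap _ _ g]er.
  have -> : \sum_u (f + g)^`M(u).@[p] * w u =
     \sum_u f^`M(u).@[p] * w u + \sum_u g^`M(u).@[p] * w u.
    by rewrite -big_split; apply: eq_bigr => u _; rewrite mderivD mevalD mulrDl.
  by rewrite -!mul_polyC !polyCD; ring.
- set a := \sum_u f^`M(u).@[p] * w u in eq; set b := \sum_u g^`M(u).@[p] * w u in er.
  have -> : \sum_u (f * g)^`M(u).@[p] * w u = a * g.@[p] + f.@[p] * b.
    rewrite mulr_suml mulr_sumr -big_split; apply: eq_bigr => u _.
    by rewrite mderivM mevalD !mevalM /= mulrDl mulrAC mulrA.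
  exists ((a * b)%:P + q * mmap polyC x g + ((f.@[p])%:P + a *: 'X) * r).
  rewrite !rmorphM /= [mmap _ _ f]eq er -!mul_polyC !polyCD !polyCM.
  by ring.
Qed.

Section Multiplicity.
Variables (C : numClosedFieldType) (n d : nat).
Local Notation M := (ncoefs n d).
Local Notation A := {mpoly C[M]}.
Variable Res : A.
Hypothesis hRes : is_resultant Res.
Hypotheses (n_gt0 : (0 < n)%N) (d_gt0 : (0 < d)%N).
Local Notation I := (@sys_pow C n d).
Variables (v0 : 'I_n) (U0 : 'I_M -> C) (pts : seq 'rV[C]_n).

(** Jacobian matrix of [F_0(x) + lambda x^[d]] at [lambda = 0]: the coordinate [x_v0] is frozen at 1
    and [lambda] takes its column. *)
Definition jacobian (p : 'rV[C]_n) : 'M[C]_n :=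
  \matrix_(v, u) if u == v0 then p 0 v ^+ d
                 else ((sys_form U0 v)^`M(u)).@[p 0].

Hypothesis uniq_pts : uniq pts.
Hypothesis pts_norm : forall p, p \in pts -> p 0 v0 = 1.
Hypothesis pts_zero : forall p v, p \in pts -> sys_eval U0 (p 0) v = 0.
Hypothesis pts_jacobian : forall p, p \in pts -> jacobian p \in unitmx.


(** [Res(U0 + X W)] with generic [W]; its first nonzero coefficient is the leading form of [Res] at
    [U0]. *)
Definition res_pencil : {poly A} :=
  mmap (polyC \o mpolyC M (R:=C)) (fun j => (U0 j)%:MP%:P + ('X_j)%:P * 'X) Res.

Lemma horner_res_pencil (W : 'I_M -> C) (t : C) :
  (map_poly (meval W) res_pencil).[t] = Res.@[fun j => U0 j + t * W j].
Proof.
rewrite (@rmorph_mmap _ _ _ _ _ _ _ (fun j => (U0 j)%:P + W j *: 'X)); last first.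
  move=> j; rewrite rmorphD rmorphM /= !map_polyC /= map_polyX mevalC mevalXU.
  by rewrite mul_polyC.
rewrite -[LHS]/(horner_eval t _).
rewrite (@rmorph_mmap _ _ _ _ _ _ _ (fun j => U0 j + t * W j)).
  by apply: mmap_ext => // c /=; rewrite map_polyC /= mevalC /horner_eval hornerC.
by move=> j; rewrite /= /horner_eval hornerD hornerC hornerZ hornerX mulrC.
Qed.

Lemma res_pencil_pow : map_poly (meval I) res_pencil = res_line Res U0.
Proof.
apply/eqP; rewrite -subr_eq0; apply/eqP; apply: contrapT => /eqP.
case/poly_neq0_eval => t; rewrite hornerD hornerN horner_res_pencil.
by rewrite horner_res_line subrr eqxx.
Qed.

Lemma res_pencil_neq0 : res_pencil != 0.
Proof.
have [D /(_ U0)[sz _]] := res_line_size hRes n_gt0.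
rewrite -res_pencil_pow in sz; apply: contra_eqN sz => /eqP ->.
by rewrite rmorph0 size_poly0.
Qed.

(* [k] is the order of vanishing of [Res] at [U0]. *)
Lemma res_pencil_order : exists2 k, res_pencil`_k != 0 &
  forall j, (j < k)%N -> res_pencil`_j = 0.
Proof.
have ex : exists j, res_pencil`_j != 0.
  exists (size res_pencil).-1; rewrite -lead_coefE lead_coef_eq0.
  exact: res_pencil_neq0.
case: (ex_minnP ex) => k k0 kmin; exists k => // j jk; apply/eqP.
by apply: contraTT jk => /kmin; rewrite -leqNgt.
Qed.

(** [res_line Res U0] is the pencil in the particular direction [I], so its coefficients of index
    below [k] vanish too. *)
Lemma order_le_mup k : (forall j, (j < k)%N -> res_pencil`_j = 0) ->
  (k <= mup 0%R (res_line Res U0))%N.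
Proof.
move=> hk; have [D /(_ U0)[sz _]] := res_line_size hRes n_gt0.
rewrite mup_geq -?size_poly_gt0 ?sz // subr0.
rewrite -(poly_take_drop k (res_line Res U0)) dvdp_addl ?dvdp_mull //.
rewrite (_ : take_poly k _ = 0) ?dvdp0 //; apply/polyP => j.
rewrite coef_take_poly coef0; case: ifP => // /hk h.
by rewrite -res_pencil_pow coef_map h /= meval0.
Qed.

(* The leading term of [Res] at [U0] vanishes on the velocities at [U0] of
   curves of systems having a common zero. *)
Lemma lead_term_vanish k (V : 'I_M -> {poly C}) :
  (forall j, (j < k)%N -> res_pencil`_j = 0) ->
  (forall t, Res.@[fun j => U0 j + t * (V j).[t]] = 0) ->
  (res_pencil`_k).@[fun j => (V j).[0]] = 0.
Proof.
move=> hk hV.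
(* [S] is [Res(U0 + t V(t))] as a polynomial in [t]. It vanishes identically, and since the pencil
   starts at order [k] its coefficient of [t^k] is the leading term evaluated at [V(0)]. *)
pose S : {poly C} := \sum_(j < size res_pencil) 'X^j * mmap polyC V res_pencil`_j.
have evalV t f : (mmap polyC V f).[t] = f.@[fun j => (V j).[t]].
  rewrite -[LHS]/(horner_eval t _).
  rewrite (@rmorph_mmap _ _ _ _ _ _ _ (fun j => (V j).[t])) //.
  by apply: mmap_ext => // c /=; rewrite /horner_eval hornerC.
have S0 : S = 0.
  apply/eqP; apply: contrapT => /negP/poly_neq0_eval[t].
  suff -> : S.[t] = Res.@[fun j => U0 j + t * (V j).[t]] by rewrite hV eqxx.
  rewrite -(horner_res_pencil (fun j => (V j).[t]) t) (horner_coef_wide _ (size_poly _ _)).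
  rewrite horner_sum.
  apply: eq_bigr => j _.
  by rewrite coef_map hornerM hornerXn evalV mulrC.
have [kS|kS] := ltnP k (size res_pencil); last first.
  by rewrite nth_default ?meval0.
have : \sum_(j < size res_pencil) ('X^j * mmap polyC V res_pencil`_j)`_k = 0.
  by rewrite -coef_sum -/S S0 coef0.
rewrite (bigD1 (Ordinal kS)) //= big1 ?addr0 => [|j].
  by rewrite coefXnM ltnn subnn -horner_coef0 evalV.
rewrite -val_eqE /= neq_ltn => /orP[jk|kj]; last by rewrite coefXnM kj.
by rewrite hk // rmorph0 mulr0 coef0.
Qed.

(** The polynomial is the coefficient of [X^k] in [Res(U0 + X (W + t I))], where [t] occurs only
    multiplied by [X]. *)
Lemma res_pencil_size (k : nat) (W : 'I_M -> C) :
  (size (mmap polyC (fun j => (W j)%:P + I j *: 'X) res_pencil`_k)%R <= k.+1)%N.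
Proof.
pose X j : {poly {poly C}} := (U0 j)%:P%:P + ((W j)%:P + I j *: 'X)%:P * 'X.
have -> : mmap polyC (fun j => (W j)%:P + I j *: 'X) res_pencil`_k =
    (mmap (polyC \o polyC) X Res)`_k.
  rewrite -coef_map (@rmorph_mmap _ _ _ _ _ _ _ X).
    by congr ((polyseq _)`_k); apply: mmap_ext => // c /=; rewrite map_polyC /= mmapC.
  move=> j; rewrite rmorphD rmorphM /= !map_polyC /= map_polyX mmapC.
  by rewrite mmapX mmap1U.
elim/mpoly_ring_ind: (Res) k => [c|j|f g hf hg|f g hf hg] k.
- rewrite mmapC /= coefC; case: eqP => _; rewrite ?size_poly0 //.
  by rewrite (leq_trans (size_polyC_leq1 _)).
- rewrite mmapX mmap1U /X coefD coefC coefCM coefX.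
  case: k => [|[|k]] /=;
      rewrite ?mulr0 ?addr0 ?add0r ?mulr1 ?size_poly0 ?size_polyC_leq1 //.
  rewrite (leq_trans (size_polyD _ _)) // geq_max.
  rewrite (leq_trans (size_polyC_leq1 _)) //.
  by rewrite (leq_trans (size_scale_leq _ _)) // size_polyX.
- by rewrite raddfD coefD (leq_trans (size_polyD _ _)) // geq_max hf hg.
- rewrite rmorphM coefM (leq_trans (size_sum _ _ _)) //; apply/bigmax_leqP => i _.
  have le_ik : (i <= k)%N by rewrite -ltnS.
  by have := size_polyM_le (hf i) (hg (k - i)%N); rewrite subnKC.
Qed.

(** First-order motion of the zero [p] when the system moves in the direction [W]; the entry [v0] is
    the coefficient [c_p] for which [p] lifts in the direction [W + c_p I]. *)
Definition velocity (p : 'rV[C]_n) (W : 'I_M -> C) : 'cV[C]_n :=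
  - (invmx (jacobian p) *m \col_v sys_eval W (p 0) v).

Lemma jacobian_velocity p W v : p \in pts ->
  sys_eval W (p 0) v + velocity p W v0 0 * p 0 v ^+ d +
  \sum_u ((sys_form U0 v)^`M(u)).@[p 0] *
     (if u == v0 then 0 else velocity p W u 0) = 0.
Proof.
move=> pp; set y := velocity p W.
have /matrixP/(_ v 0) : jacobian p *m y = - \col_v sys_eval W (p 0) v.
  by rewrite mulmxN mulKVmx ?pts_jacobian.
rewrite mxE [RHS]mxE [X in - X]mxE (bigD1 v0) //= [X in X * _]mxE eqxx => e.
rewrite [X in _ + X](_ : _ = \sum_(u < n | u != v0) jacobian p v u * y u 0).
  by rewrite -addrA [y v0 0 * _]mulrC e subrr.
rewrite (bigD1 v0) //= eqxx mulr0 add0r; apply: eq_bigr => u uv.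
by rewrite [X in _ = X * _]mxE (negbTE uv).
Qed.

(* [p + t w] is a common zero, up to terms in [t^2], of the pencil with
   velocity [W + c I]; the coefficients of [x_v0^d] absorb these terms. *)
Lemma lead_term_root k p W : p \in pts ->
  (forall j, (j < k)%N -> res_pencil`_j = 0) ->
  (res_pencil`_k).@[fun j => W j + velocity p W v0 0 * I j] = 0.
Proof.
move=> pp hk; set c := velocity p W v0 0.
pose w u := if u == v0 then 0 else velocity p W u 0.
pose x (u : 'I_n) : {poly C} := (p 0 u)%:P + w u *: 'X.
have xv0 : x v0 = 1 by rewrite /x /w eqxx scale0r addr0 pts_norm.
have taylor (U : 'I_M -> C) v : exists q, sys_eval (fun j => (U j)%:P) x v =
   (sys_eval U (p 0) v)%:P + (\sum_u ((sys_form U v)^`M(u)).@[p 0] * w u) *: 'X + 'X^2 * q.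
  have [q qE] := mmap_taylor (p 0) w (sys_form U v); exists q.
  rewrite -(sys_form_eval U v (p 0)) -qE raddf_sum; apply: eq_bigr => m _ /=.
  by rewrite mmapZ mmapX.
have step v : exists q, sys_eval (fun j => (U0 j)%:P + 'X * (W j + c * I j)%:P) x v =
    'X^2 * q.
  have [q qE] := taylor U0 v; have [r rE] := taylor (fun j => W j + c * I j) v.
  rewrite sys_evalD sys_evalZ qE rE pts_zero //.
  set b := \sum_u _ in rE *; rewrite sys_evalD sys_evalZ sys_pow_eval.
  have := jacobian_velocity W v pp; rewrite -/c.
  rewrite -[\sum_u _]/(\sum_u (sys_form U0 v)^`M(u).@[p 0] * w u) => e.
  exists (q + b%:P + 'X * r); rewrite (_ : \sum_u _ =
      - (sys_eval W (p 0) v + c * p 0 v ^+ d)).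
    by rewrite -!mul_polyC polyCN polyC0; ring.
  by apply/eqP; rewrite -addr_eq0 addrC e.
have /choice[q qE] := step.
(* Since [x v0 = 1], the monomial [X_v0^d] has value 1 at [x], so the remainder [q v] can be
   realized as the value of a form. *)
pose Y : 'I_M -> {poly C} := coefs (fun v => (q v)%:MP * 'X_v0 ^+ d : {mpoly {poly C}[n]}).
have YE v : sys_eval Y x v = q v.
  rewrite coefs_eval ?mevalM ?mevalC ?rmorphXn /= ?mevalXU ?xv0 ?expr1n ?mulr1 //.
  rewrite mpolyXn mul_mpolyC; apply: rpredZ.
  by rewrite dhomogX /= mdegMn mdeg1 mul1n.
pose V j := (W j + c * I j)%:P - 'X * Y j.
have -> : (fun j => W j + c * I j) = (fun j => (V j).[0]).
  by apply/funext => j; rewrite /V hornerD hornerN hornerM hornerX hornerC mul0r subr0.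
apply: lead_term_vanish => // t.
apply/(system_resultant_eq0 hRes); exists (fun u => (x u).[t]) => [|v].
  by exists v0; rewrite xv0 hornerC oner_eq0.
have : sys_eval (fun j => (U0 j)%:P + 'X * V j) x v = 0.
  transitivity (sys_eval (fun j =>
      ((U0 j)%:P + 'X * (W j + c * I j)%:P) + (- 'X^2) * Y j) x v).
    by apply: sys_eval_ext => // j; rewrite /V; ring.
  by rewrite sys_evalD sys_evalZ qE YE mulNr subrr.
move/(congr1 (horner_eval t)); rewrite rmorph_sys_eval rmorph0 => e.
have hv u (f : {poly C}) : u + t * f.[t] = (u%:P + 'X * f).[t].
  by rewrite hornerD hornerM hornerX hornerC.
by rewrite -[RHS]e; apply: sys_eval_ext => // j; apply: hv.
Qed.

(** The number [c_p] as a polynomial in the coefficients [W], so that a generic [W] can be chosen to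
    separate these numbers. *)
Definition speed_form (p : 'rV[C]_n) : A :=
  - \sum_v (invmx (jacobian p) v0 v)%:MP *
     sys_eval (fun j => 'X_j) (fun u => (p 0 u)%:MP) v.

Lemma speed_form_eval p W : (speed_form p).@[W] = velocity p W v0 0.
Proof.
rewrite /speed_form mevalN [RHS]mxE; congr (- _); rewrite raddf_sum [RHS]mxE.
apply: eq_bigr => v _.
rewrite /= mevalM mevalC mxE; congr (_ * _).
rewrite rmorph_sys_eval; apply: sys_eval_ext => j /=; first exact: mevalXU.
exact: mevalC.
Qed.

(** The row [v0] of the inverse Jacobian has a nonzero entry, of index [v] say. Testing on systems
    supported in equation [v], the monomial [X_v0^d] shows that the two entries agree, and
    [X_v0^(d-1) X_u] that the coordinates [u] of [p] and [q] agree. *)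
Lemma speed_form_inj p q : p \in pts -> q \in pts ->
  speed_form p = speed_form q -> p = q.
Proof.
move=> pp qq e.
have [K KE] : exists K : 'rV[C]_n -> 'I_n -> C, forall r v, invmx (jacobian r) v0 v = K r v.
  by exists (fun r => invmx (jacobian r) v0).
have [v pv] : exists v, K p v != 0.
  apply: contrapT => h; have := mulVmx (pts_jacobian pp).
  move=> /matrixP/(_ v0 v0); rewrite !mxE eqxx big1 => [/eqP|v _].
    by rewrite eq_sym oner_eq0.
  rewrite KE; have [->|nz] := eqVneq (K p v) 0; first by rewrite mul0r.
  by case: h; exists v.
have velE r (W : 'I_M -> C) : velocity r W v0 0 = - \sum_v K r v * sys_eval W (r 0) v.
  rewrite mxE; congr (- _); rewrite mxE; apply: eq_bigr => u _.
  by rewrite KE mxE.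
have : forall W : 'I_M -> C, \sum_v K p v * sys_eval W (p 0) v =
    \sum_v K q v * sys_eval W (q 0) v.
  by move=> W; apply/eqP; rewrite -eqr_opp -!velE -!speed_form_eval e.
move: (pts_norm pp) (pts_norm qq) pv; move: (K p) (K q) => {KE velE K e} k l p1 q1 kv kl.
have test (G : {mpoly C[n]}) : G \is d.-homog -> k v * G.@[p 0] = l v * G.@[q 0].
  move=> hG; pose H v' := if v' == v then G else 0.
  have hH v' : H v' \is d.-homog by rewrite /H; case: ifP => // _; apply: rpred0.
  have side (k' : 'I_n -> C) r : \sum_v' k' v' * sys_eval (coefs H : 'I_M -> C) r v' =
      k' v * G.@[r].
    rewrite (bigD1 v) //= big1 => [|v' v'v];
        first by rewrite addr0 (coefs_eval _ (hH v)) /H eqxx.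
    by rewrite (coefs_eval _ (hH v')) /H (negbTE v'v) meval0 mulr0.
  by have := kl (coefs H); rewrite !side.
have homX u e' : ('X_u ^+ e' : {mpoly C[n]}) \is e'.-homog.
  by rewrite mpolyXn dhomogX /= mdegMn mdeg1 mul1n.
have mevalXn u e' r : ('X_u ^+ e' : {mpoly C[n]}).@[r] = r u ^+ e'.
  by rewrite rmorphXn /= mevalXU.
have eqv : k v = l v.
  by have := test _ (homX v0 d); rewrite !mevalXn p1 q1 !expr1n !mulr1.
apply/rowP => u; have homG : ('X_v0 ^+ d.-1 * 'X_u ^+ 1 : {mpoly C[n]}) \is d.-homog.
  by have := dhomogM (homX v0 d.-1) (homX u 1%N); rewrite addn1 prednK.
have := test _ homG; rewrite !mevalM !mevalXn p1 q1 !expr1n !mul1r !expr1 -eqv.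
exact: (mulfI kv).
Qed.

Lemma speed_formP : exists s : 'rV[C]_n -> A,
  (forall p W, (s p).@[W] = velocity p W v0 0) /\ {in pts &, injective s}.
Proof. by exists speed_form; split; [apply: speed_form_eval|apply: speed_form_inj]. Qed.

Lemma mup_ge_zeros : (size pts <= mup 0%R (res_line Res U0))%N.
Proof.
have [speed [speedE speedI]] := speed_formP.
have [k k0 hk] := res_pencil_order.
apply: leq_trans (order_le_mup hk).
(* Where [L] is nonzero at [W], the polynomial [Q(W + t I)] in [t], with [Q] the leading form, is
   nonzero of degree at most [k] and has the distinct speeds of the points as roots. *)
pose L := res_pencil`_k * \prod_(p <- pts) \prod_(q <- pts | q != p) (speed p - speed q).
have L0 : L != 0.
  rewrite mulf_neq0 // prodf_seq_neq0; apply/allP => p pp /=.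
  rewrite prodf_seq_neq0; apply/allP => q qq; apply/implyP => qp.
  by rewrite subr_eq0; apply: contra qp => /eqP/(speedI _ _ pp qq) ->.
have [W] := mpoly_neq0_eval L0.
rewrite mevalM mulf_eq0 negb_or => /andP[Wk].
rewrite rmorph_prod prodf_seq_neq0 => /allP hW.
pose S : {poly C} := mmap polyC (fun j => (W j)%:P + I j *: 'X) res_pencil`_k.
have SE t : S.[t] = (res_pencil`_k).@[fun j => W j + t * I j].
  rewrite -[LHS]/(horner_eval t _).
  rewrite (@rmorph_mmap _ _ _ _ _ _ _ (fun j => W j + t * I j)).
    by apply: mmap_ext => // c /=; rewrite /horner_eval hornerC.
  by move=> j; rewrite /= /horner_eval hornerD hornerC hornerZ hornerX mulrC.
have S0 : S != 0.
  apply: contraNneq Wk => S0; have := SE 0; rewrite S0 horner0 => ->.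
  by apply/eqP/meval_eq => j; rewrite mul0r addr0.
pose rs := [seq velocity p W v0 0 | p <- pts].
have rtS : all (root S) rs.
  by apply/allP => _ /mapP[p pp ->]; apply/eqP; rewrite SE lead_term_root.
have urs : uniq rs.
  rewrite map_inj_in_uniq // => p q pp qq e; apply/eqP; apply: contraT => pq.
  have := hW p pp; rewrite /= rmorph_prod prodf_seq_neq0 => /allP/(_ q qq).
  rewrite eq_sym pq /= => /eqP[].
  by rewrite -/(meval W _) mevalB !speedE e subrr.
have := max_poly_roots S0 rtS urs; rewrite size_map => h.
by rewrite -ltnS (leq_trans h) // res_pencil_size.
Qed.
End Multiplicity.

(** * Multiplicity of a root of the resultant: upper bound *)

Lemma exists_max_norm (C : numDomainType) (T : finType) (t0 : T) (x : T -> C) :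
  exists v, forall u, `|x u| <= `|x v|.
Proof.
suff [v vP] : exists v, {in enum T, forall u, `|x u| <= `|x v|}.
  by exists v => u; apply: vP; rewrite mem_enum.
elim: (enum T) => [|a s [v vP]]; first by exists t0.
have := @real_leVge C `|x a| `|x v| (normr_real _) (normr_real _).
case/orP => h; [exists v|exists a] => u; rewrite inE => /orP[/eqP->|/vP us] //.
exact: le_trans us h.
Qed.

Section UltraSystems.
Variables (C : numClosedFieldType) (F : set_system nat) (n d : nat).
Hypothesis ultraF : UltraFilter F.
Local Notation M := (ncoefs n d).
Let properF : ProperFilter F := @ultra_proper _ _ ultraF.
Local Existing Instance properF.

Lemma ulim_sys_eval (U : nat -> 'I_M -> C) (x : nat -> 'I_n -> C) U0 x0 v :
  (forall i, ulim F (U^~ i) (U0 i)) -> (forall u, ulim F (x^~ u) (x0 u)) ->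
  ulim F (fun j => sys_eval (U j) (x j) v) (sys_eval U0 x0 v).
Proof.
move=> hU hx; apply: ulim_sum => // m _; apply: ulimM => //.
by apply: ulim_prod => // u _; apply: ulimX.
Qed.

(** An algebraic mean value identity: for a product, the slopes are [a g(y) + f(z) b], with [a] and
    [b] the slopes of the factors, and they tend to the derivative given by the product rule. *)
Lemma ulim_divided_difference (y z : nat -> 'I_n -> C) (p : 'I_n -> C) :
  (forall u, ulim F (y^~ u) (p u)) -> (forall u, ulim F (z^~ u) (p u)) ->
  forall f : {mpoly C[n]}, exists2 a : nat -> 'I_n -> C,
    forall u, ulim F (a^~ u) (f^`M(u)).@[p] &
    forall j, f.@[y j] - f.@[z j] = \sum_u a j u * (y j u - z j u).
Proof.
move=> hy hz; elim/mpoly_ring_ind=> [c|i|f g [a ha aE] [b hb bE]|f g [a ha aE] [b hb bE]].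
- exists (fun _ _ => 0) => [u|j].
    by rewrite mderivC meval0; apply: ulim_cst.
  by rewrite !mevalC subrr big1 // => u _; rewrite mul0r.
- exists (fun _ u => (u == i)%:R) => [u|j].
    rewrite mderivX mnm1E eq_sym; have [->|ui] := eqVneq u i; last first.
      by rewrite scale0r meval0; apply: ulim_cst.
    rewrite scale1r (_ : (U_(i) - U_(i) = 0)%MM) ?mpolyX0 ?meval1; first exact: ulim_cst.
    by apply/mnmP => l; rewrite mnmBE mnm0E subnn.
  rewrite !mevalXU (bigD1 i) //= eqxx mul1r big1 ?addr0 // => u /negbTE ->.
  by rewrite mul0r.
- exists (fun j u => a j u + b j u) => [u|j].
    by rewrite mderivD mevalD; apply: ulimD.
  rewrite !mevalD opprD addrACA aE bE -big_split; apply: eq_bigr => u _.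
  by rewrite mulrDl.
- exists (fun j u => a j u * g.@[y j] + f.@[z j] * b j u) => [u|j].
    rewrite mderivM mevalD !mevalM; apply: ulimD => //; apply: ulimM => //.
      exact: (@ulim_meval _ _ ultraF _ g (fun u j => y j u)).
    exact: (@ulim_meval _ _ ultraF _ f (fun u j => z j u)).
  rewrite !mevalM (_ : _ - _ = (f.@[y j] - f.@[z j]) * g.@[y j] +
     f.@[z j] * (g.@[y j] - g.@[z j])); last by ring.
  rewrite aE bE mulr_suml mulr_sumr -big_split; apply: eq_bigr => u _.
  by rewrite /= mulrDl mulrAC mulrA.
Qed.

(** The coefficients vary with [j], so the slopes are taken monomial by monomial and then weighted
    by the coefficients. *)
Lemma ulim_sys_difference (U : nat -> 'I_M -> C) (y z : nat -> 'I_n -> C) U0 p v :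
  (forall i, ulim F (U^~ i) (U0 i)) ->
  (forall u, ulim F (y^~ u) (p u)) -> (forall u, ulim F (z^~ u) (p u)) ->
  exists2 a : nat -> 'I_n -> C,
    forall u, ulim F (a^~ u) ((sys_form U0 v)^`M(u)).@[p] &
    forall j, sys_eval (U j) (y j) v - sys_eval (U j) (z j) v =
      \sum_u a j u * (y j u - z j u).
Proof.
move=> hU hy hz.
have /boolp.choice[b bP] (m : monom n d) : exists b : nat -> 'I_n -> C,
   (forall u, ulim F (b^~ u) ('X_[val m]^`M(u)).@[p]) /\
   (forall j, 'X_[val m].@[y j] - 'X_[val m].@[z j] = \sum_u b j u * (y j u - z j u)).
  by have [b h1 h2] := ulim_divided_difference hy hz 'X_[val m]; exists b.
exists (fun j u => \sum_(m : monom n d) U j (cidx v m) * b m j u) => [u|j].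
  rewrite (_ : (sys_form U0 v)^`M(u).@[p] = \sum_(m : monom n d)
    U0 (cidx v m) * ('X_[val m]^`M(u)).@[p]).
    by apply: ulim_sum => // m _; apply: ulimM => //; have [] := bP m.
  by rewrite /sys_form (raddf_sum (mderiv u)) raddf_sum; apply: eq_bigr => m _;
      rewrite /= mderivZ mevalZ.
rewrite -sumrB (eq_bigr (fun m : monom n d =>
  U j (cidx v m) * \sum_u b m j u * (y j u - z j u))) => [|m _]; last first.
  by have [_ <-] := bP m; rewrite -mulrBr !mevalX.
under eq_bigr do rewrite mulr_sumr.
rewrite exchange_big; apply: eq_bigr => u _.
by rewrite mulr_suml; apply: eq_bigr => m _; rewrite mulrA.
Qed.

End UltraSystems.

Section UpperBound.
Variables (C : numClosedFieldType) (n d : nat).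
Local Notation M := (ncoefs n d).
Local Notation A := {mpoly C[M]}.
Variable Res : A.
Hypothesis hRes : is_resultant Res.
Hypotheses (n_gt0 : (0 < n)%N) (d_gt0 : (0 < d)%N).
Local Notation I := (@sys_pow C n d).

(** Division by a coordinate of maximal modulus. The bound provides limits, and the coordinate equal
    to 1 keeps them nonzero. *)
Lemma normalized_zero (U : 'I_M -> C) : Res.@[U] = 0 ->
  exists x : 'I_n -> C, [/\ forall u, `|x u| <= 1, exists u, x u = 1 &
    forall v, sys_eval U x v = 0].
Proof.
move/(system_resultant_eq0 hRes) => [x [i xi] xU].
have [v vP] := exists_max_norm i x.
have xv : x v != 0 by rewrite -normr_gt0 (lt_le_trans _ (vP i)) ?normr_gt0.
exists (fun u => (x v)^-1 * x u); split=> [u||l].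
- rewrite normrM normfV mulrC ler_pdivrMr ?normr_gt0 // mul1r; exact: vP.
- by exists v; rewrite mulVf.
- by rewrite sys_eval_scale xU mulr0.
Qed.

Variable F : set_system nat.
Hypothesis ultraF : UltraFilter F.
Let properF : ProperFilter F := @ultra_proper _ _ ultraF.
Local Existing Instance properF.
Local Open Scope classical_set_scope.

(** On the line from [U0] to a point [U1] with [D.@[U1] != 0], the polynomial [D] vanishes at
    finitely many parameters. As [s] is injective, finitely many indices are affected, and there
    [U1] itself is taken. *)
Lemma separable_approximation (s : nat -> C) (U0 : 'I_M -> C) :
  injective s -> ulim F s 0 -> (forall N, F [set j | (N <= j)%N]) ->
  exists U : nat -> 'I_M -> C,
    (forall j, separable.separable_poly (res_line Res (U j))) /\
    (forall i, ulim F (U^~ i) (U0 i)).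
Proof.
move=> sI s0 hF; have [D D0 hD] := res_line_separable hRes n_gt0.
have [U1 DU1] := mpoly_neq0_eval D0.
pose q : {poly C} := mmap polyC (fun i => (U0 i)%:P + (U1 i - U0 i) *: 'X) D.
have qE t : q.[t] = D.@[fun i => U0 i + t * (U1 i - U0 i)].
  rewrite -[LHS]/(horner_eval t _).
  rewrite (@rmorph_mmap _ _ _ _ _ _ _ (fun i => U0 i + t * (U1 i - U0 i))).
    by apply: mmap_ext => // c /=; rewrite /horner_eval hornerC.
  by move=> j; rewrite /= /horner_eval hornerD hornerC hornerZ hornerX mulrC.
have q0 : q != 0.
  apply: contraNneq DU1 => q0; have := qE 1; rewrite q0 horner0 => ->.
  by apply/eqP/meval_eq => i; rewrite mul1r addrC subrK.
pose W j i := U0 i + s j * (U1 i - U0 i).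
pose U j := if q.[s j] == 0 then U1 else W j.
exists U; split=> [j|i].
  by apply: hD; rewrite /U; case: ifP => [//|/negbT]; rewrite qE.
apply: (@ulim_near _ _ ultraF (W^~ i)).
  have [N hN] : exists N, forall j, (N <= j)%N -> q.[s j] != 0.
    apply: contrapT => h.
    have bad N : exists j, (N <= j)%N && (q.[s j] == 0).
      apply: contrapT => h'; apply: h; exists N => j Nj.
      by apply: contrapT => /negP; rewrite negbK => qj; apply: h'; exists j; rewrite Nj.
    (* Bad indices beyond every bound would give [q] as many distinct roots as its size. *)
    have grow k : exists l : seq nat, [/\ uniq l, size l = k & all (fun j =>
        q.[s j] == 0) l].
      elim: k => [|k [l [ul sl al]]]; first by exists [::].
      have [j /andP[lj qj]] := bad (\max_(i <- l) i).+1.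
      exists (j :: l); split=> /=; rewrite ?sl ?qj ?ul ?andbT //.
      apply/negP => jl; have := @leq_bigmax_seq _ l xpredT id j jl isT.
      by rewrite leqNgt lj.
    have [l [ul sl al]] := grow (size q).
    have := @max_poly_roots _ q [seq s j | j <- l] q0.
    rewrite size_map sl ltnn map_inj_uniq // ul all_map => H.
    by have := H al isT.
  by apply: filterS (hF N) => j /= /hN /negbTE qj; rewrite /U qj.
rewrite -[X in ulim _ _ X]addr0 -[X in _ + X](mul0r (U1 i - U0 i)).
apply: ulimD => //; first exact: (ulim_cst ultraF).
by apply: ulimM => //; exact: (ulim_cst ultraF).
Qed.

Variables (v0 : 'I_n) (U0 : 'I_M -> C) (pts : seq 'rV[C]_n).
Hypothesis pts_complete : forall p : 'rV[C]_n, p != 0 ->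
  (forall v, sys_eval U0 (p 0) v = 0) ->
  p 0 v0 != 0 /\ (p 0 v0)^-1 *: p \in pts.
Hypothesis pts_jacobian : forall p, p \in pts -> jacobian v0 U0 p \in unitmx.

(* Two zeros [y], [z] at parameters [a], [b], both near the same point, satisfy
   [B (y - z, a - b) = 0] for a matrix [B] close to the Jacobian. *)
Lemma ulim_zero_unique (U : nat -> 'I_M -> C) (a b : nat -> C)
    (y z : nat -> 'I_n -> C) (p : 'rV[C]_n) :
  (forall i, ulim F (U^~ i) (U0 i)) -> ulim F a 0 ->
  (forall u, ulim F (y^~ u) (p 0 u)) -> (forall u, ulim F (z^~ u) (p 0 u)) ->
  F [set j | y j v0 = 1] -> F [set j | z j v0 = 1] ->
  (forall j v, sys_eval (fun i => U j i + a j * I i) (y j) v = 0) ->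
  (forall j v, sys_eval (fun i => U j i + b j * I i) (z j) v = 0) ->
  p \in pts -> F [set j | a j = b j].
Proof.
move=> hU ha hy hz y1 z1 yU zU pp.
pose W j i := U j i + a j * I i.
have hW i : ulim F (W^~ i) (U0 i).
  rewrite -[U0 i]addr0 -[X in _ + X](mul0r (I i)); apply: ulimD => //.
  by apply: ulimM => //; apply: ulim_cst.
have /boolp.choice[D DP] v : exists a : nat -> 'I_n -> C,
    (forall u, ulim F (a^~ u) ((sys_form U0 v)^`M(u)).@[p 0]) /\
    (forall j, sys_eval (W j) (y j) v - sys_eval (W j) (z j) v =
       \sum_u a j u * (y j u - z j u)).
  by have [D h1 h2] := ulim_sys_difference ultraF v hW hy hz; exists D.
pose B j : 'M[C]_n := \matrix_(v, u) if u == v0 then z j v ^+ d else D v j u.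
have hB : ulim F (fun j => \det (B j)) (\det (jacobian v0 U0 p)).
  apply: ulim_det => // v u; apply: (@ulim_ext _ _ ultraF
    (fun j => if u == v0 then z j v ^+ d else D v j u)) => [j|]; first by rewrite mxE.
  rewrite mxE; case: eqP => _; first by apply: ulimX.
  by have [h _] := DP v; apply: h.
have := pts_jacobian pp; rewrite unitmxE unitfE => J0.
apply: filterS (filterI (ulim_neq0 ultraF hB J0) (filterI y1 z1)) => j [/= Bj [yj zj]].
pose e : 'cV[C]_n := \col_u if u == v0 then a j - b j else y j u - z j u.
have Be : B j *m e = 0.
  apply/colP => v; rewrite !mxE (bigD1 v0) //= !mxE eqxx.
  rewrite (eq_bigr (fun u => D v j u * (y j u - z j u))) => [|u /negbTE uv]; last first.
    by rewrite !mxE uv.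
  have [_ /(_ j)] := DP v.
  rewrite (bigD1 v0) //= yj zj subrr mulr0 add0r => <-.
  rewrite yU (_ : sys_eval (W j) (z j) v =
      sys_eval (fun i => U j i + b j * I i) (z j) v + (a j - b j) * z j v ^+ d).
    by rewrite zU !add0r mulrC subrr.
  by rewrite !sys_evalD !sys_evalZ sys_pow_eval; ring.
have Bu : B j \in unitmx by rewrite unitmxE unitfE.
have /colP/(_ v0) : e = 0 by rewrite -(mulKmx Bu e) Be mulmx0.
by rewrite !mxE eqxx => /eqP; rewrite subr_eq0 => /eqP.
Qed.

Hypothesis compactF : forall (z : nat -> C) (B : C),
  F [set j | `|z j| <= B] -> exists c, ulim F z c.
Variable U : nat -> 'I_M -> C.
Hypothesis hU : forall i, ulim F (U^~ i) (U0 i).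
Hypothesis sepU : forall j, separable.separable_poly (res_line Res (U j)).

Lemma mup_le_zeros : (mup 0%R (res_line Res U0) <= size pts)%N.
Proof.
have [D hD] := res_line_size hRes n_gt0.
have /boolp.choice[r rP] j : exists r : seq C, [/\ res_line Res (U j) =
    \prod_(z <- r) ('X - z%:P),
    uniq r & size r = D].
  have [r rE] := closed_field_poly_normal (res_line Res (U j)).
  have [sz lc] := hD (U j); exists r; rewrite lc scale1r in rE; split=> //.
    by rewrite -separable.separable_prod_XsubC -rE.
  by apply/eqP; rewrite -eqSS -sz rE size_prod_XsubC.
pose z (i : 'I_D) j := nth 0 (r j) i.
have /boolp.choice[x xP] (ij : 'I_D * nat) : exists x : 'I_n -> C,
    [/\ forall u, `|x u| <= 1, exists u, x u = 1 &
      forall v, sys_eval (fun l => U ij.2 l + z ij.1 ij.2 * I l) x v = 0].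
  case: ij => i j /=; apply: normalized_zero; rewrite -horner_res_line.
  have [-> ur sr] := rP j.
  rewrite horner_prod (big_rem (z i j)) /= ?hornerXsubC ?subrr ?mul0r //.
  by rewrite mem_nth ?sr.
have /boolp.choice[zeta hzeta] i : exists c, ulim F (z i) c.
  apply: (@compactF _ (\sum_l (`|U0 l| + 1))).
  have /= nearU : F [set j | forall l, `|U j l - U0 l| < 1].
    suff : forall s : seq 'I_M, F [set j | forall l, l \in s -> `|U j l - U0 l| < 1].
      move/(_ (enum 'I_M)); apply: filterS => j /= h l; apply: h.
      by rewrite mem_enum.
    elim=> [|l s IH]; first by apply: filterS filterT.
    apply: filterS (filterI (hU l ltr01) IH) => j [/= h1 h2] l'.
    by rewrite inE => /orP[/eqP->|/h2].
  apply: filterS nearU => j /= hj.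
  have [x1 [u xu] xz] := xP (i, j).
  (* At a coordinate with [x u = 1], equation [u] expresses the root as minus the value of a form of
     [U j] at a point of the unit polydisc, so the coefficients bound it. *)
  have := xz u; rewrite sys_evalD sys_evalZ sys_pow_eval xu expr1n mulr1 => /eqP.
  rewrite addr_eq0 => /eqP e; rewrite -normrN -e.
  have bound l : `|U j l| <= `|U0 l| + 1.
    rewrite -[U j l](subrK (U0 l)) addrC (le_trans (ler_normD _ _)) // lerD2l.
    exact: ltW.
  apply: le_trans (ler_norm_sum _ _ _) _.
  apply: (@le_trans _ _ (\sum_(m : monom n d) (`|U0 (cidx u m)| + 1))).
    apply: ler_sum => m _; rewrite normrM -[leRHS]mulr1; apply: ler_pM => //.
    rewrite normr_prod; apply: prodr_ile1 => l _.
    by rewrite normr_ge0 normrX exprn_ile1.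
  pose h (c : coef_index n d) : C := `|U0 (enum_rank c)| + 1.
  rewrite [leRHS](reindex (fun c : coef_index n d => enum_rank c)) /=; last first.
    by apply: onW_bij; apply: enum_rank_bij.
  rewrite [leRHS](_ : _ = \sum_(v : 'I_n) \sum_(m : monom n d) h (v, m)); last first.
    by rewrite pair_bigA; apply: eq_bigr => -[].
  rewrite (bigD1 u) //= lerDl; apply: sumr_ge0 => v _; apply: sumr_ge0 => m _.
  by rewrite addr_ge0.
have /boolp.choice[xi hxi] (iu : 'I_D * 'I_n) : exists c, ulim F (fun j => x (iu.1,
    j) iu.2) c.
  apply: (@compactF _ 1); apply: filterS filterT => j _ /=.
  by have [h _ _] := xP (iu.1, j); apply: h.
(* The factorizations pass to the limit, so the multiplicity of 0 is the number of indices [i] with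
   [zeta i = 0]. *)
have lineE : res_line Res U0 = \prod_(i < D) ('X - (zeta i)%:P).
  apply/eqP; rewrite -subr_eq0; apply: contraT => /poly_neq0_eval[t].
  rewrite hornerD hornerN subr_eq0 => /eqP[].
  apply: (ulim_unique ultraF (z := fun j => (res_line Res (U j)).[t])).
    rewrite horner_res_line; apply: (@ulim_ext _ _ ultraF (fun j => Res.@[fun l =>
        U j l + t * I l])).
      by move=> j; rewrite horner_res_line.
    apply: (ulim_meval ultraF Res (z := fun l j => U j l + t * I l)) => l.
    by apply: ulimD => //; exact: (ulim_cst ultraF).
  rewrite horner_prod; apply: (@ulim_ext _ _ ultraF (fun j => \prod_(i < D) (t - z i j))).
    move=> j; have [-> ur sr] := rP j.
    rewrite horner_prod (big_nth 0) sr big_mkord; apply: eq_bigr => i _.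
    by rewrite hornerXsubC.
  apply: ulim_prod => // i _; rewrite hornerXsubC; apply: ulimB => //.
  exact: (ulim_cst ultraF).
pose Z := [seq i <- enum 'I_D | zeta i == 0].
have -> : mup 0%R (res_line Res U0) = size Z.
  rewrite lineE -(big_map zeta predT (fun c => 'X - c%:P)) mu_prod_XsubC.
  by rewrite count_map size_filter; congr count; rewrite ?enumT.
pose p i : 'rV[C]_n := \row_u xi (i, u).
have pZ i : zeta i = 0 -> p i 0 v0 != 0 /\ (p i 0 v0)^-1 *: p i \in pts.
  move=> zi; apply: pts_complete.
    (* Which coordinate equals 1 may depend on [j]; the product over all coordinates expresses that
       some coordinate does in a form that passes to the limit. *)
    have : \prod_u (xi (i, u) - 1) = 0.
      apply: (ulim_unique ultraF (z := fun j => \prod_u (x (i, j) u - 1))).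
        apply: ulim_prod => // u _; apply: ulimB => //; first exact: (hxi (i, u)).
        exact: (ulim_cst ultraF).
      apply: (@ulim_ext _ _ ultraF (fun=> 0)); last exact: (ulim_cst ultraF).
      move=> j; have [_ [u xu] _] := xP (i, j).
      by rewrite (bigD1 u) //= xu subrr mul0r.
    move/eqP; rewrite prodf_seq_eq0 => /hasP[u _ /=]; rewrite subr_eq0 => /eqP xu.
    by apply: contra_eq_neq xu => /rowP/(_ u); rewrite !mxE => ->; rewrite eq_sym oner_eq0.
  move=> v; rewrite (@sys_eval_ext _ _ _ _ U0 _ (fun u => xi (i, u))) //; last first.
    by move=> u; rewrite mxE.
  apply: (ulim_unique ultraF (z := fun j => sys_eval (fun l =>
      U j l + z i j * I l) (x (i, j)) v)).
    apply: ulim_sys_eval => // [l|u]; last exact: (hxi (i, u)).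
    rewrite -[U0 l]addr0 -[X in _ + X](mul0r (I l)) -zi; apply: ulimD => //.
    by apply: ulimM => //; exact: (ulim_cst ultraF).
  apply: (@ulim_ext _ _ ultraF (fun=> 0)); last exact: (ulim_cst ultraF).
  by move=> j; have [_ _ ->] := xP (i, j).
pose q i := (p i 0 v0)^-1 *: p i.
pose y i j u := (x (i, j) v0)^-1 * x (i, j) u.
have hy i u : zeta i = 0 -> ulim F ((y i)^~ u) (q i 0 u).
  move=> /pZ[pi0 _]; rewrite !mxE in pi0 *; apply: ulimM => //.
    by apply: ulimV => //; exact: (hxi (i, v0)).
  exact: (hxi (i, u)).
have y1 i : zeta i = 0 -> F [set j | y i j v0 = 1].
  move=> /pZ[pi0 _]; rewrite mxE in pi0.
  have := ulim_neq0 ultraF (hxi (i, v0)) pi0.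
  by apply: filterS => j /= h; rewrite /y mulVf.
(* If two indices had the same limit point, their roots would coincide for some [j] by
   [ulim_zero_unique], while the roots of a separable polynomial are listed without repetition. *)
have qI : {in Z &, injective q}.
  move=> i i'; rewrite !mem_filter => /andP[/eqP zi _] /andP[/eqP zi' _] e.
  apply/eqP; apply: contraT => ii'.
  have yz i1 j v : sys_eval (fun l => U j l + z i1 j * I l) (y i1 j) v = 0.
    by rewrite sys_eval_scale; have [_ _ ->] := xP (i1, j); rewrite mulr0.
  have hz : ulim F (z i) 0 by rewrite -zi; apply: hzeta.
  have hy' u : ulim F ((y i')^~ u) (q i 0 u) by rewrite e; apply: hy.
  have := ulim_zero_unique hU hz (fun u => hy i u zi) hy' (y1 i zi) (y1 i' zi')
    (yz i) (yz i') (pZ i zi).2.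
  case/filter_ex => j /= /eqP; have [_ ur sr] := rP j.
  by rewrite /z nth_uniq ?sr // => /eqP/val_inj e'; rewrite e' eqxx in ii'.
rewrite -(size_map q Z); apply: uniq_leq_size.
  by rewrite map_inj_in_uniq // filter_uniq // enum_uniq.
by move=> _ /mapP[i iZ ->]; move: iZ; rewrite mem_filter => /andP[/eqP /pZ[]].
Qed.
End UpperBound.

(** * Zeros of the Laplacian tensor *)

Lemma prod_mpolyX (R : comNzRingType) (n : nat) (s : seq 'I_n) :
  \prod_(j <- s) 'X_j = 'X_[\sum_(j <- s) U_(j)] :> {mpoly R[n]}.
Proof.
elim: s => [|i s IH]; first by rewrite !big_nil mpolyX0.
by rewrite !big_cons IH mpolyXD.
Qed.

Section TensorSystem.
Variables (C : fieldType) (d n : nat) (A : tensor C d.+1 n).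
Local Notation M := (ncoefs n d).

Definition tensor_form (i : 'I_n) : {mpoly C[n]} :=
  tensor_apply (fun t => (A t)%:MP) (fun j => 'X_j) i.

(** With this sign, adding [lambda] times [sys_pow] yields the system that defines the
    characteristic polynomial. *)
Definition tensor_coefs : 'I_M -> C := coefs (fun i => - tensor_form i).

Lemma tensor_form_homog i : tensor_form i \is d.-homog.
Proof.
apply: rpred_sum => t _; rewrite mul_mpolyC; apply: rpredZ.
rewrite prod_mpolyX dhomogX /= mdeg_sum.
rewrite (eq_bigr (fun=> 1%N)) => [|j _]; last by rewrite mdeg1.
by rewrite sum1_size size_behead size_tuple.
Qed.

Lemma tensor_form_eval x i : (tensor_form i).@[x] = tensor_apply A x i.
Proof.
rewrite raddf_sum; apply: eq_bigr => t _ /=; rewrite mevalM mevalC rmorph_prod.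
by congr (_ * _); apply: eq_bigr => j _; rewrite /= mevalXU.
Qed.

Lemma tensor_coefs_eval x i : sys_eval tensor_coefs x i = - tensor_apply A x i.
Proof.
by rewrite coefs_eval ?rpredN ?tensor_form_homog // mevalN tensor_form_eval.
Qed.

Lemma sys_form_tensor i : sys_form tensor_coefs i = - tensor_form i.
Proof. by rewrite sys_form_coefs ?rpredN ?tensor_form_homog. Qed.

Lemma tensor_char_polyE (Res : {mpoly C[M]}) :
  tensor_char_poly (k := d.+1) Res A =
  mmap polyC (fun j => (tensor_coefs j)%:P + sys_pow C j *: 'X) Res.
Proof.
apply: mmap_ext => // j; rewrite /tensor_coefs /sys_pow /coefs /char_system /=.
set i := (enum_val j).1; set m : 'X_{1..n} := val (val _).
rewrite mcoeffB mcoeffCM mcoeffN polyCN addrC; congr (_ + _); last first.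
  by rewrite !mpolyXn !mcoeffX -mul_polyC rmorph_nat mulrC.
congr (- _); rewrite !raddf_sum; apply: eq_bigr => t _.
by rewrite /= !prod_mpolyX !mcoeffCM !mcoeffX polyCM rmorph_nat.
Qed.
End TensorSystem.

(** Monomials are eigenvectors of Euler's operator [x_u d/dx_u]; this computes the rescaled Jacobian
    without lowering exponents. *)
Lemma euler_mpolyX (R : comNzRingType) (n : nat) (m : 'X_{1..n}) (p : 'I_n -> R) u :
  p u * (('X_[m] : {mpoly R[n]})^`M(u)).@[p] = (m u)%:R * ('X_[m] : {mpoly R[n]}).@[p].
Proof.
rewrite mderivX mevalZ mulrCA; have [->|mu] := posnP (m u); first by rewrite !mul0r.
congr (_ * _); rewrite -[p u](@mevalXU _ _ p u) -mevalM -mpolyXD addmC submK //.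
by rewrite lep1mP -lt0n.
Qed.

Lemma euler_mpoly_prod (R : comNzRingType) (n : nat) (A : {set 'I_n}) (p : 'I_n -> R) u :
  p u * ((\prod_(j in A) ('X_j : {mpoly R[n]}))^`M(u)).@[p] =
  (u \in A)%:R * \prod_(j in A) p j.
Proof.
have XA : \prod_(j in A) ('X_j : {mpoly R[n]}) = 'X_[\sum_(j in A) U_(j)].
  by rewrite -big_enum prod_mpolyX big_enum.
rewrite XA euler_mpolyX -XA; congr (_%:R * _); last first.
  by rewrite rmorph_prod; apply: eq_bigr => j _; rewrite /= mevalXU.
rewrite mnm_sumE; have [uA|uA] := boolP (u \in A).
  rewrite (bigD1 u) //= mnm1E eqxx big1 // => j /andP[_ ju].
  by rewrite mnm1E (negbTE ju).
by rewrite big1 // => j jA; rewrite mnm1E; case: eqP => // ju; rewrite -ju jA in uA.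
Qed.

(** * The Laplacian tensor of a connected uniform hypergraph *)

Section Laplacian.
Variables (C : numClosedFieldType) (V : finType) (E : {set {set V}}) (d : nat).
Hypothesis d_gt0 : (0 < d)%N.
Hypothesis unifE : uniform E d.+1.
Hypothesis connE : hconnected E.
Local Notation n := #|V|.
Implicit Types (e : {set V}) (i j u v : 'I_n).

Definition inc e : {set 'I_n} := [set j | enum_val j \in e].
Definition link e i : {set 'I_n} := inc e :\ i.

Lemma card_inc e : e \in E -> #|inc e| = d.+1.
Proof.
move=> /unifE <-; rewrite -(card_imset _ enum_val_inj); apply: eq_card => v.
apply/imsetP/idP => [[j + ->]|ve]; first by rewrite inE.
by exists (enum_rank v); rewrite ?inE enum_rankK.
Qed.

Lemma card_link e i : e \in E -> i \in inc e -> #|link e i| = d.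
Proof.
by move=> eE ie; move: (card_inc eE); rewrite (cardsD1 i) ie => -[].
Qed.

Lemma hdegreeE i : hdegree E (enum_val i) = (\sum_(e in E | i \in inc e) 1)%N.
Proof.
by rewrite sum1dep_card; apply: eq_card => e; rewrite !inE.
Qed.

Lemma connected_ind (P : 'I_n -> Prop) i :
  (forall e j u, e \in E -> j \in inc e -> u \in inc e -> P j -> P u) ->
  P i -> forall u, P u.
Proof.
move=> step Pi u; have [_ /(_ (enum_val i) (enum_val u))] := connE.
case/connectP => s sp su.
have : P (enum_rank (last (enum_val i) s)); last by rewrite -su enum_valK.
have : P (enum_rank (enum_val i)) by rewrite enum_valK.
elim: s (enum_val i) sp {su} => //= y s IH x /andP[xy sp] Px; apply: IH => //.
have /existsP[e /andP[eE /andP[xe ye]]] := xy.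
by apply: (step e (enum_rank x)) => //; rewrite inE enum_rankK.
Qed.

(** The index tuples starting with [i] whose support is a given edge [e] at [i] are the [d!]
    orderings of the other vertices of [e], and this cancels the factor [1 / d!]. *)
Lemma laplacian_form i :
  tensor_form (laplacian_tensor E C d.+1) i =
  ((hdegree E (enum_val i))%:R)%:MP * 'X_i ^+ d
  - \sum_(e in E | i \in inc e) \prod_(j in link e i) 'X_j.
Proof.
rewrite /tensor_form /tensor_apply.
pose h (s : d.-tuple 'I_n) : d.+1.-tuple 'I_n := [tuple of i :: s].
have hbij : {on [pred t : d.+1.-tuple 'I_n | ohead t == Some i], bijective h}.
  exists (fun t : d.+1.-tuple 'I_n => behead_tuple t : d.-tuple 'I_n) => [s _|t];
      first exact/val_inj.
  rewrite inE /=; case/tupleP: t => a s /= /eqP[->]; exact/val_inj.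
rewrite (reindex h hbij) /=.
rewrite (eq_bigl predT) => [|s]; last by rewrite eqxx.
rewrite (eq_bigr (fun s : d.-tuple 'I_n =>
   (degree_tensor E C d.+1 (h s))%:MP * \prod_(j <- s) 'X_j -
   (adjacency_tensor E C d.+1 (h s))%:MP * \prod_(j <- s) 'X_j)); last first.
  by move=> s _; rewrite /laplacian_tensor mpolyCB mulrBl.
rewrite sumrB; congr (_ - _).
  have degE s : degree_tensor E C d.+1 (h s) =
      if s == [tuple of nseq d i] then (hdegree E (enum_val i))%:R else 0.
    rewrite /degree_tensor /diag_tensor; case: eqP => [->|sd].
      rewrite (bigD1 i) /=; last by apply/eqP/val_inj.
      by rewrite big1 ?addr0 // => u /andP[/eqP/(congr1 val) /= [<-]]; rewrite eqxx.
    rewrite big1 // => u /eqP/(congr1 val) /= [iu su]; case: sd; apply/val_inj => /=.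
    by rewrite su iu.
  rewrite (bigD1 [tuple of nseq d i]) //= degE eqxx.
  rewrite [X in _ + X]big1 ?addr0 => [|s /negbTE sd]; last first.
    by rewrite degE sd mpolyC0 mul0r.
  by rewrite big_nseq iter_mulr_1.
rewrite (eq_bigr (fun s : d.-tuple 'I_n => \sum_(e in E | i \in inc e)
    (if [set enum_val a | a in h s] == e then (d`!%:R^-1)%:MP * \prod_(j <- s) 'X_j
     else 0))); last first.
  move=> s _; rewrite /adjacency_tensor; case: ifP => sE; last first.
    rewrite mpolyC0 mul0r big1 // => e /andP[eE _]; case: eqP => // e'.
    by rewrite e' eE in sE.
  rewrite (bigD1 [set enum_val a | a in h s]) /=; last first.
    by rewrite sE inE; apply/imsetP; exists i; rewrite // inE eqxx.
  rewrite eqxx [X in _ = _ + X]big1 ?addr0 // => e /andP[_ /negbTE]; rewrite eq_sym => ->.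
  by [].
rewrite exchange_big; apply: eq_bigr => e /andP[eE ie].
rewrite -big_mkcond /=.
(* As [e] has [d.+1] elements, a tuple of length [d.+1] with support [e] has no repetition. *)
have cond s : ([set enum_val a | a in h s] == e) = (all (mem (link e i)) s && uniq s).
  apply/idP/idP => [/eqP se|/andP[/allP sl us]].
    have us : uniq (h s).
      apply/card_uniqP; rewrite size_tuple; transitivity #|e|; last exact: unifE.
      by rewrite -se card_imset //; apply: enum_val_inj.
    move: us; rewrite /= => /andP[nis us]; rewrite us andbT; apply/allP => j js /=.
    rewrite !inE -se; apply/andP; split; first by apply: contraNneq nis => <-.
    by apply/imsetP; exists j; rewrite // inE js orbT.
  rewrite eqEcard; apply/andP; split.
    apply/fintype.subsetP => _ /imsetP[a + ->]; rewrite inE => /predU1P[->|/sl].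
      by rewrite inE in ie.
    by rewrite /= !inE => /andP[].
  rewrite card_imset; last exact: enum_val_inj.
  have /card_uniqP -> : uniq (h s).
    by rewrite /= us andbT; apply/negP => /sl; rewrite /= !inE eqxx.
  by rewrite size_tuple (unifE eE).
rewrite (eq_bigl _ _ cond).
rewrite (eq_bigr (fun=> (d`!%:R^-1)%:MP * \prod_(j in link e i) 'X_j)); last first.
  move=> s /andP[/allP sl us]; congr (_ * _); rewrite big_uniq //=.
  apply: eq_bigl; apply/subset_cardP; last by apply/fintype.subsetP => j /sl.
  by have /card_uniqP -> := us; rewrite size_tuple card_link.
rewrite sumr_const -[X in _ *+ X](_ : d`! = _).
  rewrite -mulrnAl -mpolyCMn -[X in X%:MP](_ : 1 = _) ?mul1r //.
  by rewrite -[RHS]mulr_natr mulVf // pnatr_eq0 -lt0n fact_gt0.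
have := card_uniq_tuples d (mem (link e i)).
rewrite -[X in X ^_ _]/#|link e i| card_link // ffactnn => <-.
by apply: eq_card => s; rewrite !inE.
Qed.

Lemma laplacian_apply x i :
  tensor_apply (laplacian_tensor E C d.+1) x i =
  (hdegree E (enum_val i))%:R * x i ^+ d
  - \sum_(e in E | i \in inc e) \prod_(j in link e i) x j.
Proof.
rewrite -tensor_form_eval laplacian_form mevalB mevalM mevalC rmorphXn /= mevalXU.
congr (_ - _); rewrite raddf_sum; apply: eq_bigr => e _ /=.
by rewrite rmorph_prod; apply: eq_bigr => j _; rewrite /= mevalXU.
Qed.

Definition laplacian_zero (x : 'I_n -> C) :=
  forall i, tensor_apply (laplacian_tensor E C d.+1) x i = 0.

(* Maximum principle: at a vertex of maximal modulus the terms of the average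
   must all be equal, and the maximum propagates along edges. *)
Lemma laplacian_zero_structure x : laplacian_zero x -> (exists i, x i != 0) ->
  (forall i, x i != 0) /\
  (forall e i, e \in E -> i \in inc e -> \prod_(j in link e i) x j = x i ^+ d).
Proof.
move=> xL [i0 xi0]; have [v vP] := exists_max_norm i0 x.
pose r := `|x v|; have r0 : 0 < r by rewrite (lt_le_trans _ (vP i0)) ?normr_gt0.
have local i : `|x i| = r -> forall e, e \in E -> i \in inc e ->
    \prod_(j in link e i) x j = x i ^+ d.
  move=> xir; have xid : x i ^+ d != 0 by rewrite expf_neq0 // -normr_gt0 xir.
  pose P e := (e \in E) && (i \in inc e).
  (* By the equation at [i] these ratios have average 1, and maximality bounds their moduli by 1;
     the equality case of the triangle inequality makes each of them 1. *)
  pose G e := (\prod_(j in link e i) x j) / x i ^+ d.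
  have G1 f : P f -> `|G f| <= 1.
    move=> /andP[fE if_]; rewrite normrM normfV ler_pdivrMr ?normr_gt0 // mul1r.
    rewrite normr_prod normrX xir -(card_link fE if_) -prodr_const.
    by apply: ler_prod => j _; rewrite normr_ge0 vP.
  have Gsum : \sum_(f | P f) G f = \sum_(f | P f) 1.
    rewrite -mulr_suml; apply: (canLR (mulfK xid)).
    have := xL i; rewrite laplacian_apply => /eqP; rewrite subr_eq0 => /eqP <-.
    by rewrite hdegreeE natr_sum.
  move=> e eE ie; have := normC_sum_upper G1 Gsum (i := e).
  by rewrite /P eE ie => /(_ isT)/(canRL (divfK xid)); rewrite mul1r.
(* On an edge at a vertex of modulus [r], a product of [d] moduli at most [r] equals [r^d], so each
   of them is [r]. *)
have all_r : forall i, `|x i| = r.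
  apply: (@connected_ind (fun i => `|x i| = r) v) => // e j u eE je ue xj.
  have [->//|uj] := eqVneq u j.
  have := congr1 (fun y : C => `|y|) (local j xj e eE je).
  rewrite /= normr_prod normrX xj => pr; apply: le_anti; rewrite vP /=.
  have ul : u \in link e j by rewrite !inE uj; rewrite inE in ue.
  move: pr; rewrite (bigD1 u) //= => pr.
  have le_rest : \prod_(i in link e j | i != u) `|x i| <= r ^+ d.-1.
    have <- : #|link e j :\ u| = d.-1.
      by move: (card_link eE je); rewrite (cardsD1 u) ul => <-.
    rewrite -prodr_const (eq_bigl (mem (link e j :\ u))) => [|i]; last first.
      by rewrite !inE andbC.
    by apply: ler_prod => i _; rewrite normr_ge0 vP.
  have : r * r ^+ d.-1 <= `|x u| * r ^+ d.-1.
    by rewrite -exprS prednK // -pr ler_wpM2l.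
  by rewrite ler_pM2r // exprn_gt0.
split=> [i|e i eE ie]; first by rewrite -normr_gt0 all_r.
exact: local.
Qed.

(** [x_i^(d+1)] is the product of [x] over any edge at [i], so it is constant on edges and, by
    connectedness, equal to its value 1 at [v0]. *)
Lemma laplacian_zero_normalized x v0 : laplacian_zero x -> x v0 = 1 ->
  (forall i, x i ^+ d.+1 = 1) /\ (forall e, e \in E -> \prod_(j in inc e) x j = 1).
Proof.
move=> xL xv0; have [|x0 xe] := laplacian_zero_structure xL.
  by exists v0; rewrite xv0 oner_eq0.
have xk e i : e \in E -> i \in inc e -> x i ^+ d.+1 = \prod_(j in inc e) x j.
  by move=> eE ie; rewrite (big_setD1 i) //= -/(link e i) xe // exprS.
have x1 : forall i, x i ^+ d.+1 = 1.
  apply: (@connected_ind (fun i => x i ^+ d.+1 = 1) v0); last by rewrite xv0 expr1n.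
  by move=> e j u eE je ue <-; rewrite (xk e) // (xk e j).
split=> // e eE; have /card_gt0P[i ie] : (0 < #|inc e|)%N by rewrite card_inc.
by rewrite -(xk e i eE ie).
Qed.

(** The maximum principle for the Laplacian matrix of the multigraph that replaces each edge by a
    clique. As [b] is complex, the modulus is maximized and the equality case of the triangle
    inequality is used. *)
Lemma harmonic_constant (b : 'I_n -> C) :
  (forall i, \sum_(e in E | i \in inc e) \sum_(u in link e i) (b i - b u) = 0) ->
  forall i j, b i = b j.
Proof.
move=> hb; suff [c cP] : exists c, forall i, b i = c by move=> i j; rewrite !cP.
have [/card_gt0P[v1 _] _] := connE.
have [v vP] := exists_max_norm (enum_rank v1) b.
have [bv0|bv0] := eqVneq (b v) 0.
  exists 0 => i; apply/eqP; rewrite -normr_eq0 -[_ == 0]orbF.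
  by have := vP i; rewrite bv0 normr0 normr_le0 => /eqP ->; rewrite normr0 eqxx.
exists (b v); apply: (@connected_ind (fun i => b i = b v) v) => // e j u eE je ue bj.
have [->//|uj] := eqVneq u j.
have := hb j; under eq_bigr do rewrite sumrB.
rewrite sumrB => /eqP; rewrite subr_eq0 !pair_big_dep /= => /eqP sums.
pose P (p : {set V} * 'I_n) := ((p.1 \in E) && (j \in inc p.1)) && (p.2 \in link p.1 j).
have G1 p : P p -> `|b p.2 / b v| <= 1.
  by move=> _; rewrite normrM normfV ler_pdivrMr ?normr_gt0 // mul1r.
have Gsum : \sum_(p | P p) b p.2 / b v = \sum_(p | P p) 1.
  rewrite -mulr_suml; apply: (canLR (mulfK bv0)); rewrite -sums mulr_suml.
  by apply: eq_bigr => p _; rewrite mul1r bj.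
have := normC_sum_upper G1 Gsum (i := (e, u)).
rewrite /P /= eE je !inE uj; rewrite inE in ue; rewrite ue.
by move=> /(_ isT)/(canRL (divfK bv0)); rewrite mul1r.
Qed.

(** A kernel vector [a] of the Jacobian is rescaled to [b_u = a_u / p_u], with [b_v0 = 0]. Since [p]
    has product 1 on every edge, the scaled derivatives form the Laplacian matrix of the clique
    multigraph ([deriv]), and the kernel equations say that it maps [b] to the constant [a_v0]. *)
Lemma laplacian_jacobian v0 (p : 'rV[C]_n) : laplacian_zero (p 0) -> p 0 v0 = 1 ->
  jacobian v0 (tensor_coefs (laplacian_tensor E C d.+1)) p \in unitmx.
Proof.
move=> pL pv0; have [pk pe] := laplacian_zero_normalized pL pv0.
have p0 i : p 0 i != 0.
  by apply: contraTneq isT => pi0; have := pk i; rewrite pi0 expr0n => /eqP;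
      rewrite eq_sym oner_eq0.
set J := jacobian _ _ _; rewrite unitmxE unitfE -det_tr; apply/det0P => -[y y0 yJ].
pose a u := y 0 u; pose b u := if u == v0 then 0 else a u / p 0 u.
have deriv v u : p 0 v * (p 0 u * ((tensor_form (laplacian_tensor E C d.+1)
    v)^`M(u)).@[p 0]) =
    \sum_(e in E | v \in inc e) \sum_(w in link e v) ((u == v)%:R - (u == w)%:R).
  rewrite laplacian_form mderivB mevalB mulrBr mulrBr.
  have -> : p 0 v * (p 0 u * (((hdegree E (enum_val v))%:R%:MP * 'X_v ^+ d)^`M(u)).@[p 0]) =
      \sum_(e in E | v \in inc e) \sum_(w in link e v) (u == v)%:R.
    rewrite mderiv_mulC mevalM mevalC [p 0 u * _]mulrCA [LHS]mulrCA mpolyXn.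
    rewrite euler_mpolyX mulmnE mnm1E -mpolyXn rmorphXn /= mevalXU.
    rewrite [p 0 v * _]mulrCA -exprS pk mulr1 hdegreeE natr_sum mulr_suml.
    apply: eq_bigr => e /andP[eE ve]; rewrite mul1r sumr_const card_link //.
    by rewrite eq_sym natrM mulr_natr.
  have -> : p 0 v * (p 0 u * ((\sum_(e in E | v \in inc e) \prod_(j in link e v)
      'X_j)^`M(u)).@[p 0]) =
      \sum_(e in E | v \in inc e) \sum_(w in link e v) (u == w)%:R.
    rewrite (raddf_sum (mderiv u)) (raddf_sum (meval (p 0))) /= !mulr_sumr.
    apply: eq_bigr => e /andP[eE ve]; rewrite euler_mpoly_prod mulrCA.
    have -> : p 0 v * \prod_(j in link e v) p 0 j = \prod_(j in inc e) p 0 j.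
      by rewrite [RHS](big_setD1 v ve).
    rewrite pe // mulr1; have [ul|ul] := boolP (u \in link e v).
      rewrite (bigD1 u) //= eqxx big1 ?addr0 // => w /andP[_ wu].
      by rewrite eq_sym (negbTE wu).
    by rewrite big1 // => w wl; case: eqP => // uw; rewrite uw wl in ul.
  by rewrite -sumrB; apply: eq_bigr => e _; rewrite -sumrB.
have row v : a v0 = \sum_(e in E | v \in inc e) \sum_(u in link e v) (b v - b u).
  have := congr1 (fun B : 'rV[C]_n => B 0 v * p 0 v) yJ; rewrite /= [in X in _ =
      X]mxE mul0r.
  rewrite mxE (bigD1 v0) //= mulrDl !mxE eqxx -/(a v0) -mulrA -exprSr pk mulr1.
  move=> /eqP; rewrite addr_eq0 => /eqP ->; rewrite -mulNr -sumrN mulr_suml.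
  transitivity (\sum_u b u * (p 0 v * (p 0 u *
      ((tensor_form (laplacian_tensor E C d.+1) v)^`M(u)).@[p 0]))).
    rewrite [RHS](bigD1 v0) //= /b eqxx mul0r add0r; apply: eq_bigr => u uv.
    rewrite (negbTE uv) !mxE (negbTE uv) sys_form_tensor mderivN mevalN -/(a u).
    by field; apply: p0.
  transitivity (\sum_u \sum_(e in E | v \in inc e) \sum_(w in link e v)
      b u * ((u == v)%:R - (u == w)%:R)).
    apply: eq_bigr => u _; rewrite deriv mulr_sumr; apply: eq_bigr => e _.
    exact: mulr_sumr.
  rewrite exchange_big; apply: eq_bigr => e _ /=.
  rewrite exchange_big; apply: eq_bigr => w _ /=.
  have pick_b z : \sum_u b u * (u == z)%:R = b z.
    rewrite (bigD1 z) //= eqxx mulr1 big1 ?addr0 // => u /negbTE ->.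
    by rewrite mulr0.
  by rewrite -(pick_b v) -(pick_b w) -sumrB; apply: eq_bigr => u _; rewrite mulrBr.
(* Summed over all vertices, the differences [b v - b u] cancel within each edge, so the constant is
   0; then [b] is harmonic, hence constant, and equal to [b v0 = 0]. *)
have c0 : a v0 = 0.
  have : \sum_(v < n) a v0 = 0.
    rewrite (eq_bigr _ (fun v _ => row v)) (exchange_big_dep (mem E)) /=;
        last by move=> v e _ /andP[].
    rewrite big1 // => e eE; rewrite (eq_bigl (mem (inc e))) => [|v]; last by rewrite eE.
    rewrite (eq_bigr (fun v => \sum_(u in inc e) (b v - b u))) => [|v ve]; last first.
      by rewrite (big_setD1 v ve) /= subrr add0r.
    by under eq_bigr do rewrite sumrB; rewrite sumrB [X in _ - X]exchange_big subrr.
  rewrite sumr_const card_ord -mulr_natl => /eqP; rewrite mulf_eq0 pnatr_eq0.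
  by have [/lt0n_neq0/negbTE -> _] := connE; move=> /eqP.
have bc : forall u, b u = 0.
  move=> u; rewrite (@harmonic_constant b _ u v0); first by rewrite /b eqxx.
  by move=> i; rewrite -row.
case/eqP: y0; apply/rowP => u; rewrite mxE -/(a u).
have [->//|uv] := eqVneq u v0.
have := bc u; rewrite /b (negbTE uv) => /eqP;
    rewrite mulf_eq0 invr_eq0 (negbTE (p0 u)) orbF.
by move/eqP.
Qed.
End Laplacian.

(** * Lines in the eigenvariety *)

Section Lines.
Variables (C : numClosedFieldType) (n : nat) (v0 : 'I_n).
Local Open Scope classical_set_scope.
Implicit Types (p q x : 'rV[C]_n) (Z : set 'rV[C]_n).

Definition pline p : set 'rV[C]_n := [set x | exists t, x = t *: p].

Definition restrict_line p (f : {mpoly C[n]}) : {poly C} :=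
  mmap polyC (fun u => p 0 u *: 'X) f.

Lemma horner_restrict_line p f t : (restrict_line p f).[t] = f.@[(t *: p) 0].
Proof.
rewrite -[LHS]/(horner_eval t _).
rewrite (@rmorph_mmap _ _ _ _ _ _ _ (fun u => (t *: p) 0 u)).
  by apply: mmap_ext => // c /=; rewrite /horner_eval hornerC.
by move=> u; rewrite /= /horner_eval hornerZ hornerX mxE mulrC.
Qed.

Lemma algebraic_set_empty : algebraic_set (set0 : set 'rV[C]_n).
Proof.
exists setT; apply/seteqP; split=> x //= /(_ 1 Logic.I).
by rewrite meval1 => /eqP; rewrite oner_eq0.
Qed.

Lemma algebraic_setU Z1 Z2 :
  algebraic_set Z1 -> algebraic_set Z2 -> algebraic_set (Z1 `|` Z2).
Proof.
move=> [I1 ->] [I2 ->].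
exists [set h | exists f g, [/\ I1 f, I2 g & h = f * g]].
apply/seteqP; split=> x /=.
  case=> hx _ [f [g [If Ig ->]]]; rewrite mevalM.
    by rewrite (hx f If) mul0r.
  by rewrite (hx g Ig) mulr0.
move=> hx; have [|/existsNP[f /not_implyP[If fx]]] := pselect (zero_locus I1 x).
  by left.
right=> g Ig; have := hx (f * g) (ex_intro _ f (ex_intro _ g (And3 If Ig erefl))).
by rewrite mevalM => /eqP; rewrite mulf_eq0 => /orP[/eqP/fx|/eqP].
Qed.

Lemma irreducible_subset_union (T : eqType) (s : seq T) (Y : T -> set 'rV[C]_n) Z :
  irreducible_set Z -> (forall a, a \in s -> algebraic_set (Y a)) ->
  (forall x, Z x -> exists2 a, a \in s & Y a x) ->
  exists2 a, a \in s & Z `<=` Y a.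
Proof.
move=> [Zn0 Zirr]; elim: s => [|a s IH] algY cov.
  by case: Zn0 => x /cov[].
pose Ys := [set x | exists2 b, b \in s & Y b x].
have algYs : algebraic_set Ys.
  rewrite /Ys; elim: (s) (fun b bs => algY b (@mem_behead _ (a :: s) b bs)) =>
      [|b l IHl] algl.
    rewrite (_ : mkset _ = set0); first exact: algebraic_set_empty.
    by apply/seteqP; split=> x //= [].
  rewrite (_ : mkset _ = Y b `|` [set x | exists2 b, b \in l & Y b x]).
    apply: algebraic_setU; first by apply: algl; rewrite mem_head.
    by apply: IHl => c cl; apply: algl; rewrite inE cl orbT.
  apply/seteqP; split=> x /=.
    move=> [c]; rewrite inE => /predU1P[->|cl] Yc; first by left.
    by right; exists c.
  case=> [Yb|[c cl Yc]]; first by exists b; rewrite // mem_head.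
  by exists c; rewrite // inE cl orbT.
have [|h|h] := Zirr (Y a) Ys (algY a (mem_head _ _)) algYs.
- by move=> x /cov[b]; rewrite inE => /predU1P[->|bs] Yb; [left|right; exists b].
- by exists a; rewrite ?mem_head.
have [b bs|x /h //|b bs Zb] := IH.
  by apply: algY; rewrite inE bs orbT.
by exists b; rewrite // inE bs orbT.
Qed.

Lemma algebraic_set1 x : algebraic_set [set x].
Proof.
exists [set f | exists u, f = 'X_u - (x 0 u)%:MP]; apply/seteqP; split=> y /=.
  by move=> -> _ [u ->]; rewrite mevalB mevalXU mevalC subrr.
move=> h; apply/rowP => u; have := h _ (ex_intro _ u erefl).
by rewrite mevalB mevalXU mevalC => /eqP; rewrite subr_eq0 => /eqP.
Qed.

Lemma irreducible_set1 x : irreducible_set [set x].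
Proof.
split; first by exists x.
move=> Z1 Z2 _ _ h; by have [Zx|Zx] := h x erefl; [left|right] => y /= ->.
Qed.

(** Restricted to the line, polynomials become univariate: if neither closed set contains the line,
    two nonzero restrictions have a nonzero product, which is nonzero at some point of the line. *)
Lemma pline_irreducible p : irreducible_set (pline p).
Proof.
split; first by exists p, 1; rewrite scale1r.
move=> _ _ [I1 ->] [I2 ->] h; apply: contrapT => /not_orP[].
have pick I : ~ pline p `<=` zero_locus I -> exists2 f, I f & restrict_line p f != 0.
  move=> /existsNP[x /not_implyP[[t ->] /existsNP[f /not_implyP[If fx]]]].
  exists f => //; apply: contra_not_neq fx => f0.
  by rewrite -horner_restrict_line f0 horner0.
move=> /pick[f If f0] /pick[g Ig g0].
have := mulf_neq0 f0 g0 => /poly_neq0_eval[t].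
rewrite hornerM !horner_restrict_line mulf_eq0 negb_or => /andP[/eqP ft /eqP gt].
by have [/(_ f If)|/(_ g Ig)] := h (t *: p) (ex_intro _ t erefl).
Qed.

Lemma pline_algebraic p : p 0 v0 = 1 -> algebraic_set (pline p).
Proof.
move=> pv0; exists [set f | exists u, f = 'X_u - (p 0 u)%:MP * 'X_v0].
apply/seteqP; split=> y /=.
  move=> [t ->] _ [u ->]; rewrite mevalB mevalM mevalC !mevalXU !mxE pv0.
  by rewrite mulr1 mulrC subrr.
move=> h; exists (y 0 v0); apply/rowP => u; have := h _ (ex_intro _ u erefl).
rewrite mevalB mevalM mevalC !mevalXU => /eqP; rewrite subr_eq0 => /eqP ->.
by rewrite mxE mulrC.
Qed.

Lemma pline_inj p q : p 0 v0 = 1 -> q 0 v0 = 1 -> pline p `<=` pline q -> p = q.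
Proof.
move=> p1 q1 /(_ p)[|t e]; first by exists 1; rewrite scale1r.
have t1 : t = 1 by move: p1; rewrite e mxE q1 mulr1.
by rewrite e t1 scale1r.
Qed.

(** A polynomial vanishing on [Z] but not on the line has finitely many zeros on the line; they
    cover [Z], and irreducibility leaves one of them. *)
Lemma proper_irreducible_in_pline p Z : algebraic_set Z -> irreducible_set Z ->
  Z `<=` pline p -> ~ pline p `<=` Z -> exists a, Z `<=` [set a].
Proof.
move=> [I ->] irrZ Zp /existsNP[x /not_implyP[[t0 ->] /existsNP[f /not_implyP[If fx]]]].
have f0 : restrict_line p f != 0.
  apply: contra_not_neq fx => f0.
  by rewrite -horner_restrict_line f0 horner0.
have [r rE] := closed_field_poly_normal (restrict_line p f).
have [//|y /[dup] Zy /Zp[t yE]|a _ Za] :=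
    @irreducible_subset_union _ r (fun t => [set t *: p]) _ irrZ.
- by move=> t _; apply: algebraic_set1.
- exists t => //; have := Zy _ If; rewrite yE -horner_restrict_line => /eqP.
  rewrite rE hornerZ mulf_eq0 lead_coef_eq0 (negbTE f0) /= => /eqP h.
  have : root (\prod_(z <- r) ('X - z%:P)) t by apply/eqP.
  by rewrite root_prod_XsubC.
by exists (a *: p).
Qed.

(** The chain from the origin to the line has length 1. In a chain of length 2 the middle set would
    be a single point, hence equal to the nonempty set below it. *)
Lemma pline_dim p : p 0 v0 = 1 -> algebraic_dim (pline p) = 1%N.
Proof.
move=> p1; have p0 : p != 0.
  by apply: contraTneq isT => e; move: p1; rewrite e mxE => /eqP; rewrite eq_sym oner_eq0.
have ub d : irreducible_chain (pline p) d -> (d <= 1)%N.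
  move=> [Z [ZP Zlt]]; rewrite leqNgt; apply/negP => d2.
  have [alg1 irr1 sub1] := ZP 1%N (ltnW d2).
  have [_ [[x Z0x] _] _] := ZP 0%N isT.
  have [_ _ sub2] := ZP 2%N d2.
  have [s01 n10] := Zlt 0%N (ltnW d2); have [s12 n21] := Zlt 1%N d2.
  have np : ~ pline p `<=` Z 1%N by move=> h; apply: n21 => y /sub2/h.
  have [a Za] := proper_irreducible_in_pline alg1 irr1 sub1 np.
  apply: n10 => y /Za ->; have /Za e := s01 _ Z0x.
  by rewrite -[X in Z _ X]e.
have ch : irreducible_chain (pline p) 1.
  exists (fun i => if i == 0%N then [set 0] else pline p); split=> [[|i] _ /=|[|i] //= _].
  - split; [exact: algebraic_set1|exact: irreducible_set1|].
    by move=> x /= ->; exists 0; rewrite scale0r.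
  - by split; [exact: pline_algebraic|exact: pline_irreducible|].
  - split; first by move=> x /= ->; exists 0; rewrite scale0r.
    move=> /(_ p (ex_intro _ 1 (esym (scale1r p)))) /= e.
    by move: p0; rewrite e eqxx.
rewrite /algebraic_dim; case: xgetP => [d _ [chd maxd]|/(_ 1%N)[]].
  by apply/eqP; rewrite eqn_leq ub // maxd.
by split.
Qed.
End Lines.

(** * Components and projective points of a finite union of lines *)

Section LineUnion.
Variables (C : numClosedFieldType) (n : nat) (v0 : 'I_n) (pts : seq 'rV[C]_n).
Hypothesis uniq_pts : uniq pts.
Hypothesis pts_norm : forall p, p \in pts -> p 0 v0 = 1.
Variable S : set 'rV[C]_n.
Hypothesis SE : forall x, S x <-> exists2 p, p \in pts & pline p x.
Local Open Scope classical_set_scope.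

Lemma line_union_components :
  irreducible_component S = [set Z | exists2 p, p \in pts & Z = pline p].
Proof.
have sub_line Z : irreducible_set Z -> Z `<=` S -> exists2 p, p \in pts & Z `<=` pline p.
  move=> irrZ ZS; apply: irreducible_subset_union => // [p pp|x /ZS/SE //].
  exact: pline_algebraic (pts_norm pp).
have lineS p : p \in pts -> pline p `<=` S.
  by move=> pp x px; apply/SE; exists p.
apply/seteqP; split=> Z /=.
  move=> [irrZ ZS maxZ]; have [p pp Zp] := sub_line Z irrZ ZS; exists p => //.
  by apply/esym/maxZ => //; [exact: pline_irreducible|exact: lineS].
move=> [p pp ->]; split; [exact: pline_irreducible|exact: lineS|].
move=> Z' irrZ' pZ' Z'S; have [q qq Z'q] := sub_line Z' irrZ' Z'S.
have pq : p = q.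
  by apply: (pline_inj (pts_norm pp) (pts_norm qq)) => x /pZ'/Z'q.
by apply/seteqP; split=> //; rewrite pq.
Qed.

Lemma line_union_components_sum k kappa (Z : 'I_kappa -> set 'rV[C]_n) :
  injective Z -> range Z = irreducible_component S ->
  (\sum_(i < kappa) algebraic_dim (Z i) * k ^ (algebraic_dim (Z i) - 1))%N = size pts.
Proof.
move=> Zinj; rewrite line_union_components => rZ.
have /boolp.choice[p pP] i : exists p, p \in pts /\ Z i = pline p.
  have : range Z (Z i) by exists i.
  by rewrite rZ => -[p pp e]; exists p.
(* Every component has dimension 1 and contributes [1 * k ^ 0 = 1]. *)
rewrite (eq_bigr (fun=> 1%N)) => [|i _]; last first.
  by have [pp ->] := pP i; rewrite (pline_dim (pts_norm pp)) subnn expn0.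
rewrite sum1_card card_ord.
have sz : size [seq p i | i <- enum 'I_kappa] = kappa by rewrite size_map size_enum_ord.
apply/eqP; rewrite eqn_leq -[X in (X <= _)%N && _]sz -[X in _ && (_ <= X)%N]sz.
apply/andP; split; apply: uniq_leq_size => //.
- rewrite map_inj_uniq ?enum_uniq // => i j e; apply: Zinj.
  by have [_ ->] := pP i; have [_ ->] := pP j; rewrite e.
- by move=> _ /mapP[i _ ->]; have [] := pP i.
move=> q qq; have : range Z (pline q) by rewrite rZ; exists q.
case=> i _ e; apply/mapP; exists i; rewrite ?mem_enum //.
have [pp pE] := pP i; apply: (pline_inj (pts_norm qq) (pts_norm pp)).
by rewrite -pE e.
Qed.

Lemma line_union_projective :
  ([set L : {vspace 'rV[C]_n} | \dim L = 1%N /\ forall x, x \in L -> S x]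
    #= `I_(size pts))%card.
Proof.
pose f k : {vspace 'rV[C]_n} := <[nth 0%R pts k]>%VS.
rewrite (_ : mkset _ = [set f k | k in `I_(size pts)]).
  apply: inj_card_eq => i j /set_mem /= ilt /set_mem /= jlt e.
  have ip := mem_nth 0 ilt; have jp := mem_nth 0 jlt.
  apply/eqP; rewrite -(nth_uniq 0 ilt jlt uniq_pts); apply/eqP.
  apply: (pline_inj (pts_norm ip) (pts_norm jp)) => _ [t ->].
  by apply/vlineP; rewrite -[<[_]>%VS]/(f j) -e memvZ // memv_line.
apply/seteqP; split=> [L [dL LS]|_ [k /= kp <-]]; last first.
  have kpts := mem_nth 0 kp; split.
    rewrite dim_vline; case: eqP => // e; have := pts_norm kpts.
    by rewrite e mxE => /eqP; rewrite eq_sym oner_eq0.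
  by move=> x /vlineP[t ->]; apply/SE; exists (nth 0 pts k) => //; exists t.
(* One nonzero vector of [L] already lies on some line through a point [p] of [pts], and it spans
   [L]. *)
have x0 : vpick L != 0 by rewrite vpick0 -dimv_eq0 dL.
have [p pp [t pE]] := (SE _).1 (LS _ (memv_pick L)).
have t0 : t != 0 by apply: contraNneq x0 => t0; rewrite pE t0 scale0r.
have pL : p \in L.
  by rewrite -[p]scale1r -(mulVf t0) -scalerA -pE memvZ // memv_pick.
exists (index p pts); first by rewrite /= index_mem.
have p0 : p != 0.
  by apply: contraTneq isT => e; have := pts_norm pp; rewrite e mxE => /eqP;
    rewrite eq_sym oner_eq0.
rewrite /f nth_index //; apply/eqP; have lepL : (<[p]> <= L)%VS by rewrite -memvE.
by rewrite -(dimv_leqif_eq lepL) dim_vline p0 dL.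
Qed.
End LineUnion.

(** * The normalized zeros of the Laplacian tensor and the multiplicity of 0 *)

Section LaplacianPoints.
Variables (C : numClosedFieldType) (V : finType) (E : {set {set V}}) (d : nat).
Hypothesis d_gt0 : (0 < d)%N.
Hypothesis unifE : uniform E d.+1.
Hypothesis connE : hconnected E.
Variable v0 : 'I_#|V|.

(** All coordinates of a normalized zero are roots of [X^(d+1) - 1], so the zeros are filtered from
    the finite list of vectors with such coordinates. *)
Lemma laplacian_points : exists pts : seq 'rV[C]_#|V|, uniq pts /\
  forall p, (p \in pts) <-> p 0 v0 = 1 /\ laplacian_zero E d (p 0).
Proof.
have [rs rsE] := closed_field_poly_normal ('X^(d.+1) - 1 : {poly C}).
have rsP z : z ^+ d.+1 = 1 -> z \in rs.
  move=> z1; have : root ('X^(d.+1) - 1 : {poly C}) z.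
    by apply/eqP; rewrite !hornerE z1 subrr.
  rewrite rsE rootZ ?root_prod_XsubC // lead_coef_eq0 -size_poly_eq0.
  by rewrite size_XnsubC.
pose row (f : {ffun 'I_#|V| -> 'I_(size rs)}) : 'rV[C]_#|V| := \row_i nth 0 rs (f i).
pose Q (p : 'rV[C]_#|V|) := (p 0 v0 == 1) &&
  [forall i, tensor_apply (laplacian_tensor E C d.+1) (p 0) i == 0].
have QP (p : 'rV[C]_#|V|) : reflect (p 0 v0 = 1 /\ laplacian_zero E d (p 0)) (Q p).
  by apply: (iffP andP) => -[/eqP h1 h2]; split=> //; [move=> i;
      apply/eqP/(forallP h2)|apply/forallP => i; apply/eqP].
exists (undup [seq p <- [seq row f | f <- enum {: {ffun 'I_#|V| -> 'I_(size rs)}}] | Q p]).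
split=> [|p]; first exact: undup_uniq.
rewrite mem_undup mem_filter; split=> [/andP[/QP //]|h].
rewrite (introT (QP p) h) /=; have [p1 pL] := h.
have [pk _] := laplacian_zero_normalized d_gt0 unifE connE pL p1.
apply/mapP; have lt (i : 'I_#|V|) : (index (p 0%R i) rs < size rs)%N by rewrite
    index_mem rsP.
exists [ffun i => Ordinal (lt i)]; first by rewrite mem_enum.
by apply/rowP => i; rewrite mxE ffunE /= nth_index // rsP.
Qed.

Lemma laplacian_zeroZ (t : C) (x : 'I_#|V| -> C) :
  laplacian_zero E d x -> laplacian_zero E d (fun i => t * x i).
Proof.
move=> xL i; apply: oppr_inj; rewrite -tensor_coefs_eval sys_eval_scale.
by rewrite tensor_coefs_eval xL oppr0 mulr0.
Qed.

Lemma laplacian_zero1 : laplacian_zero (C := C) E d (fun=> 1).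
Proof.
move=> i; rewrite laplacian_apply // expr1n mulr1 hdegreeE natr_sum.
by rewrite -sumrB big1 // => e _; rewrite big1 ?subrr.
Qed.

Lemma laplacian_eigenvariety (pts : seq 'rV[C]_#|V|) :
  (forall p, (p \in pts) <-> p 0 v0 = 1 /\ laplacian_zero E d (p 0)) ->
  forall x, affine_eigenvariety 0 (laplacian_tensor E C d.+1) x <->
    exists2 p, p \in pts & pline p x.
Proof.
move=> ptsP x; have zeroP (y : 'rV[C]_#|V|) :
    affine_eigenvariety 0 (laplacian_tensor E C d.+1) y <-> laplacian_zero E d (y 0).
  by split=> h i; have := h i; rewrite mul0r.
rewrite zeroP; split=> [xL|[p /ptsP[p1 pL] [t ->]] i]; last first.
  by rewrite -[RHS](laplacian_zeroZ t pL i); congr tensor_apply; apply/funext => j;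
      rewrite mxE.
(* The origin lies on every line; the all-one vector provides one. *)
have [->|x0] := eqVneq x 0.
  exists (const_mx 1); last by exists 0; rewrite scale0r.
  apply/ptsP; split; first by rewrite mxE.
  by rewrite (_ : _ 0 = fun=> 1); [exact: laplacian_zero1|apply/funext => j; rewrite mxE].
have [|xn0 _] := laplacian_zero_structure d_gt0 unifE connE xL.
  apply: contrapT => h; case/eqP: x0; apply/rowP => i; rewrite mxE.
  by apply: contrapT => /eqP xi; apply: h; exists i.
exists ((x 0 v0)^-1 *: x); last first.
  by exists (x 0 v0); rewrite scalerA divff ?xn0 // scale1r.
apply/ptsP; split; first by rewrite mxE mulVf.
rewrite (_ : _ 0 = fun j => (x 0 v0)^-1 * x 0 j); last by apply/funext => j; rewrite mxE.
exact: laplacian_zeroZ.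
Qed.
End LaplacianPoints.

Lemma laplacian_alg_mult (R : realType) (d : nat) (d_gt0 : (0 < d)%N) (V : finType)
    (E : {set {set V}}) (unifE : uniform E d.+1) (connE : hconnected E)
    (v0 : 'I_#|V|) (Res : {mpoly R[i][ncoefs #|V| d]}) (hRes : is_resultant Res)
    (pts : seq 'rV[R[i]]_#|V|) :
  uniq pts ->
  (forall p, (p \in pts) <-> p 0 v0 = 1 /\ laplacian_zero E d (p 0)) ->
  alg_mult (k := d.+1) Res 0 (laplacian_tensor E R[i] d.+1) = size pts.
Proof.
move=> upts ptsP; have [V_gt0 _] := connE.
rewrite /alg_mult tensor_char_polyE.
pose U0 := tensor_coefs (laplacian_tensor E R[i] d.+1).
rewrite -/U0 -/(res_line Res U0).
have U0E x v : laplacian_zero E d x -> sys_eval U0 x v = 0.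
  by move=> xL; rewrite tensor_coefs_eval xL oppr0.
have pts1 p : p \in pts -> p 0 v0 = 1 by move=> /ptsP[].
have ptsJ p : p \in pts -> jacobian v0 U0 p \in unitmx.
  by move=> /ptsP[p1 pL]; apply: laplacian_jacobian.
(* An ultrafilter containing all cofinal segments, along which [1 / (j + 1)] tends to 0. *)
have [F [ultraF leF]] := ultraFilterLemma eventually_filter.
have cofin N : F [set j | (N <= j)%N]%classic by apply: leF; exists N.
have invS_inj : injective (fun j => j.+1%:R^-1 : R[i]).
  by move=> i j /invr_inj/eqP; rewrite eqr_nat => /eqP[].
have [U [sepU hU]] := separable_approximation hRes V_gt0 ultraF U0 invS_inj
  (ulim_invS ultraF cofin) cofin.
apply/eqP; rewrite eqn_leq; apply/andP; split; last first.
  by apply: (mup_ge_zeros hRes V_gt0 d_gt0 upts pts1) => // p v /ptsP[_ /U0E].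
apply: (mup_le_zeros hRes V_gt0 ultraF (v0 := v0)) hU sepU => // [p p0 pU|z B].
  have pL : laplacian_zero E d (p 0).
    by move=> v; apply: oppr_inj; rewrite -tensor_coefs_eval pU oppr0.
  have /(laplacian_eigenvariety d_gt0 unifE connE ptsP)[q qq [t pE]] :
      affine_eigenvariety 0 (laplacian_tensor E R[i] d.+1) p.
    by move=> v; rewrite mul0r.
  have t0 : t != 0 by apply: contraNneq p0 => t0; rewrite pE t0 scale0r.
  have pv : p 0 v0 = t by rewrite pE mxE pts1 // mulr1.
  by rewrite pv t0 {1}pE scalerA mulVf // scale1r.
exact: ulim_bounded.
Qed.

Theorem theorem1p7 (R : realType) (k : nat) (hk : (2 <= k)%N)
    (V : finType) (E : {set {set V}})
    (hunif : uniform E k) (htree : hypertree E)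
    (Res : {mpoly R[i][ncoefs #|V| k.-1]}) (hRes : is_resultant Res) :
  let L : tensor R[i] k #|V| := laplacian_tensor E R[i] k in
  let am : nat := alg_mult Res 0%R L in
  (proj_eigenvariety 0%R L #= `I_am)%card /\
  (forall (kappa : nat) (Z : 'I_kappa -> set 'rV[R[i]]_#|V|),
     injective Z ->
     range Z = irreducible_component (affine_eigenvariety 0%R L) ->
     am = (\sum_(i < kappa)
             algebraic_dim (Z i) * (k - 1) ^ (algebraic_dim (Z i) - 1))%N).
Proof.
have [connE _] := htree; have [V_gt0 _] := connE.
(* From here on [k = d.+2], so the forms have the positive degree [d.+1]. *)
case: k hk hunif Res hRes => [|[|d]] // _ hunif Res hRes.
have [pts [upts ptsP]] :=
  @laplacian_points R[i] V E d.+1 isT hunif connE (Ordinal V_gt0).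
have ptsS := laplacian_eigenvariety (ltn0Sn d) hunif connE ptsP.
have pts1 p : p \in pts -> p 0 (Ordinal V_gt0) = 1%R by move=> /ptsP[].
move=> L am; have -> : am = size pts.
  exact: (laplacian_alg_mult (ltn0Sn d) hunif connE hRes upts ptsP).
split; first exact: (line_union_projective upts pts1 ptsS).
by move=> kappa Z Zinj rZ; rewrite (line_union_components_sum upts pts1 ptsS).
Qed.
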